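(* Let $\mathfrak g=\mathfrak{sl}(n|n)$ and let $V=\Bbbk^{n|n}$ be its defining representation. Let $x\in\mathfrak g_{\bar 1}$ be distinguished and let $\frac12[x,x]=s+f$ be the Jordan decomposition of $\frac12[x,x]$ in $\mathfrak g_{\bar 0}$ ($s$ semisimple, $f$ nilpotent). Then: (1) $s=\lambda\,\mathrm{Id}_V$ for some $\lambda\in\Bbbk$. (2) If $s\neq0$, then $f$ is a principal nilpotent element of $\mathfrak g_{\bar 0}$, embedded into a principal $\mathfrak{sl}_2$-triple $(e,h,f)$, and we have a decomposition $x=x_0+x_{-2}$ such that $[h,x_i]=ix_i$ for every $i$. In particular, $x$ is strongly balanced. (3) If $s=0$, there are two cases: either $V$ is an indecomposable $\Bbbk[x]$-module and $x$ is strongly balanced, or $V=U_1\oplus U_2$ where $U_1,U_2$ are indecomposable $\Bbbk[x]$-modules of odd dimensions and $x$ is neat.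
   Context: Base field $\Bbbk$: algebraically closed of characteristic $0$. $\mathfrak{sl}(n|n)$ is the Lie superalgebra of supertrace-zero endomorphisms of $\Bbbk^{n|n}$ with the supercommutator. ''$\Bbbk[x]$-module'' means a $\mathbb Z/2$-graded module with the action of the odd operator $x$. Semisimple/nilpotent elements of $\mathfrak g_{\bar 0}$ are those of the reductive Lie algebra $\mathfrak g_{\bar 0}$ (central elements are semisimple). A principal nilpotent element is a regular nilpotent one (for $n=1$ it is $0$, with zero triple). $\mathfrak{sl}_2$-triples satisfy $[h,e]=2e$, $[h,f]=-2f$, $[e,f]=h$. An element $x\in\mathfrak g_{\bar 1}$ is distinguished if every semisimple element of $\mathfrak g_{\bar 0}$ commuting with $x$ lies in $Z(\mathfrak g)_{\bar 0}$, where $Z(\mathfrak g)$ is the center of $\mathfrak g$. With $\frac12[x,x]=s+f$: $x$ is neat if $s=0$ and in every finite-dimensional representation of $\mathfrak g$ all Jordan blocks of the nilpotent operator $x$ have odd size. $x$ is strongly balanced if either $f=0$, or $f\neq0$ and there is an $\mathfrak{sl}_2$-triple $(e,h,f)$ in $\mathfrak g_{\bar 0}$ with $[s,h]=0$ such that in the decomposition $x=\sum_{i\le0}x_i$, $[h,x_i]=ix_i$, one has $x_{-1}=0$. *)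

(* Defs.v *)
From HB Require Import structures.
From mathcomp Require Import all_boot all_order all_algebra.

Set Implicit Arguments.
Unset Strict Implicit.
Unset Printing Implicit Defensive.

Import GRing.Theory.
Local Open Scope ring_scope.

(** Endomorphisms of k^(p|q) are matrices of size p + q acting on column
    vectors on the left; the first p coordinates are even, the last q are odd.
    A parity is a boolean ([true] = odd). *)

Section GeneralLinear.
Variables (k : fieldType) (p q : nat).
Implicit Types A B : 'M[k]_(p + q).

Definition vhom (b : bool) (v : 'cV[k]_(p + q)) : 'cV[k]_(p + q) :=
  if b then col_mx 0 (dsubmx v) else col_mx (usubmx v) 0.

Definition mxhom (b : bool) A : 'M[k]_(p + q) :=
  if b then block_mx 0 (ursubmx A) (dlsubmx A) 0
  else block_mx (ulsubmx A) 0 0 (drsubmx A).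

Fact mxhom_is_linear b : linear (mxhom b).
Proof.
move=> a A B; apply/matrixP=> i j.
case: b; rewrite /mxhom !mxE; case: splitP => i' _; rewrite !mxE;
  by case: splitP => j' _; rewrite !mxE // mulr0 addr0.
Qed.
HB.instance Definition _ b := GRing.isLinear.Build k 'M[k]_(p + q)
  'M[k]_(p + q) *:%R (mxhom b) (mxhom_is_linear b).

Definition glpart (b : bool) : {vspace 'M[k]_(p + q)} :=
  lker (linfun (mxhom (~~ b))).

(** The supercommutator: A B - (-1)^(|A||B|) B A on homogeneous elements,
    extended bilinearly. *)
Definition sbr A B : 'M[k]_(p + q) :=
  \sum_(i : bool) \sum_(j : bool)
    (mxhom i A *m mxhom j B - (-1) ^+ (i && j) *: (mxhom j B *m mxhom i A)).

Fact sbr_is_linear A : linear (sbr A).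
Proof.
move=> a B C; rewrite /sbr scaler_sumr -big_split; apply: eq_bigr => i _.
rewrite scaler_sumr -big_split; apply: eq_bigr => j _ /=.
rewrite linearP mulmxDr mulmxDl -scalemxAr -scalemxAl.
rewrite scalerDr scalerBr !scalerA (mulrC _ a) opprD.
by rewrite -!addrA; congr (_ + _); rewrite addrCA.
Qed.
HB.instance Definition _ A := GRing.isLinear.Build k 'M[k]_(p + q)
  'M[k]_(p + q) *:%R (sbr A) (sbr_is_linear A).

Definition str A : k^o := \tr (ulsubmx A) - \tr (drsubmx A).

Fact str_is_linear : linear str.
Proof.
move=> a A B; have lin m (C D E : 'M[k]_m) :
    C = a *: D + E -> \tr C = a * \tr D + \tr E.
  by move=> ->; rewrite mxtraceD mxtraceZ.
have ulE : ulsubmx (a *: A + B) = a *: ulsubmx A + ulsubmx B.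
  by apply/matrixP=> i j; rewrite !mxE.
have drE : drsubmx (a *: A + B) = a *: drsubmx A + drsubmx B.
  by apply/matrixP=> i j; rewrite !mxE.
rewrite /str (lin _ _ _ _ ulE) (lin _ _ _ _ drE) /GRing.scale /= mulrBr opprD.
by rewrite -!addrA; congr (_ + _); rewrite addrCA.
Qed.
HB.instance Definition _ := GRing.isLinear.Build k 'M[k]_(p + q) k^o *:%R
  str str_is_linear.

End GeneralLinear.

Section SpecialLinear.
Variables (k : fieldType) (n : nat).
Implicit Types x y z s f e h : 'M[k]_(n + n).

Definition sl : {vspace 'M[k]_(n + n)} := lker (linfun (@str k n n)).
Definition slpart (b : bool) : {vspace 'M[k]_(n + n)} :=
  (sl :&: glpart k n n b)%VS.
Notation g0 := (slpart false).
Notation g1 := (slpart true).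

Definition in_center z := z \in sl /\ forall y, y \in sl -> sbr z y = 0.

(** Semisimple and nilpotent elements of the reductive Lie algebra g0 are taken
    in the intrinsic sense: y is semisimple if ad y is diagonalizable on g0,
    and nilpotent if y lies in [g0, g0] and ad y is nilpotent on g0.  In
    particular central elements are semisimple and 0 is the only central
    nilpotent element. *)
Definition semisimple y :=
  y \in g0 /\
  exists2 X : seq 'M[k]_(n + n), basis_of g0 X &
    forall z, z \in X -> exists a : k, sbr y z = a *: z.

Definition der_g0 : {vspace 'M[k]_(n + n)} :=
  <<[seq sbr y z | y <- vbasis g0, z <- vbasis g0]>>%VS.

Definition nilpotent y :=
  y \in der_g0 /\
  exists m : nat, forall z, z \in g0 -> iter m (sbr y) z = 0.

Definition jordan_dec y s f :=
  [/\ semisimple s, nilpotent f, sbr s f = 0 & y = s + f].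

Definition centralizer y : {vspace 'M[k]_(n + n)} :=
  (g0 :&: lker (linfun (sbr y)))%VS.

(** Regular elements of g0 are those whose centralizer has minimal dimension. *)
Definition regular y :=
  y \in g0 /\
  forall z, z \in g0 -> (\dim (centralizer y) <= \dim (centralizer z))%N.

Definition principal_nilpotent y := nilpotent y /\ regular y.

Definition sl2_triple e h f :=
  [/\ [/\ e \in g0, h \in g0 & f \in g0],
      sbr h e = 2%:R *: e, sbr h f = - 2%:R *: f & sbr e f = h].

Definition principal_sl2_triple e h f :=
  [/\ sl2_triple e h f, principal_nilpotent e & principal_nilpotent f].

Definition half_square x := 2%:R^-1 *: sbr x x.

Definition distinguished x :=
  x \in g1 /\ forall y, semisimple y -> sbr y x = 0 -> in_center y.

(** [xs i] is the component of x of weight - i. *)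
Definition strongly_balanced x :=
  exists s f, jordan_dec (half_square x) s f /\
    (f = 0 \/
     f <> 0 /\
     exists e h, [/\ sl2_triple e h f, sbr s h = 0 &
       exists (N : nat) (xs : nat -> 'M[k]_(n + n)),
         [/\ x = \sum_(i < N) xs i,
             forall i, xs i \in g1 /\ sbr h (xs i) = - i%:R *: xs i &
             xs 1%N = 0]]).

(** A finite-dimensional representation of sl(n|n) on k^(p|q).  The linear map
    is given on all matrices, but only its restriction to sl(n|n) is used. *)
Definition representation (p q : nat)
    (rho : {linear 'M[k]_(n + n) -> 'M[k]_(p + q)}) :=
  (forall b y, y \in slpart b -> rho y \in glpart k p q b) /\
  (forall y z, y \in sl -> z \in sl -> rho (sbr y z) = sbr (rho y) (rho z)).

Definition nilpotent_jordan_mx (ms : seq nat) :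
    'M[k]_(\sum_(i < size ms) nth 0%N ms i) :=
  \mxdiag_(i < size ms)
    (\matrix_(a < nth 0%N ms i, b < nth 0%N ms i) (a.+1 == b)%:R).

(** N is similar to the nilpotent Jordan matrix with blocks of sizes ms; row
    freeness and fullness make the a priori rectangular matrix P invertible. *)
Definition has_jordan_blocks (d : nat) (N : 'M[k]_d) (ms : seq nat) :=
  exists P : 'M[k]_(\sum_(i < size ms) nth 0%N ms i, d),
    [/\ row_free P, row_full P & P *m N = nilpotent_jordan_mx ms *m P].

Definition neat x :=
  exists s f, [/\ jordan_dec (half_square x) s f, s = 0 &
    forall (p q : nat) (rho : {linear 'M[k]_(n + n) -> 'M[k]_(p + q)}),
      representation rho ->
      exists2 ms : seq nat, all odd ms & has_jordan_blocks (rho x) ms].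

(** k[x]-submodules of V = k^(n|n) are Z/2-graded and stable under x. *)
Definition submodule x (U : {vspace 'cV[k]_(n + n)}) :=
  (forall b v, v \in U -> vhom b v \in U) /\
  (forall v, v \in U -> x *m v \in U).

Definition direct_decomposition (U U1 U2 : {vspace 'cV[k]_(n + n)}) :=
  (U1 + U2)%VS = U /\ (U1 :&: U2)%VS = 0%VS.

Definition indecomposable x (U : {vspace 'cV[k]_(n + n)}) :=
  [/\ submodule x U, U <> 0%VS &
      forall U1 U2, submodule x U1 -> submodule x U2 ->
        direct_decomposition U U1 U2 -> U1 = 0%VS \/ U2 = 0%VS].

End SpecialLinear.

(* Main.v *)
Require Import Defs.
From HB Require Import structures.
From mathcomp Require Import all_boot all_order all_algebra.
From mathcomp Require Import zify ring.

(** Every polynomial in x^2 is even, commutes with x and has supertrace 0 (an even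
    y commuting with x satisfies str (y x^2) = - str (y x^2)), so the spectral
    idempotents of x^2 lie in sl(n|n) and must be scalar when x is distinguished.
    Hence x^2 has a single eigenvalue, and s is that scalar.

    Write x = [[0, A], [B, 0]].  If A or B is invertible, an idempotent commuting
    with AB (or BA) transports through the invertible block to one commuting with
    x, so AB has a single Jordan block, and in adapted bases both blocks of x are
    affine in the nilpotent shift; the principal triple and the decomposition
    x = x_0 + x_(-2) are then explicit.  This covers s <> 0, and also s = 0 when V
    is one Jordan chain, since then A and B cannot both be singular.

    Otherwise s = 0 and V splits off a homogeneous chain of x with projection p.
    Distinguishedness forces str p <> 0, so its length is odd, and a combination
    c p + c' p' of supertrace 0 shows that a second chain exhausts V.  On chains
    of odd length x extends to osp(1|2) inside sl(n|n), and in every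
    representation of osp(1|2) the lowering operator has odd Jordan blocks. *)

Set Implicit Arguments.
Unset Strict Implicit.
Unset Printing Implicit Defensive.

Import GRing.Theory.
Local Open Scope ring_scope.

(** * Jordan chains *)

Section Chains.
Variable k : fieldType.

(** Semisimple, nilpotent and regular refer to the adjoint action on g0, while the argument lives on
    V, so both directions need a bridge. Towards V: s is shown to be scalar on an eigenbasis of ad
    s, and a trace fixes the scalar. Back to g0: regularity compares with every other element, which
    needs the lower bound 2n - 1 for all centralizers, from triangularization, and a matching upper
    bound, from a vector that separates the commutant. A Jordan chain is always carried with a dual
    chain of covectors. The projection onto it is then a product of two explicit matrices and
    commutes with the nilpotent operator; complements, gradings and supertraces become matrix
    identities. In a representation of osp(1|2) the weight operator H is not known to be
    diagonalizable. Weight spaces are replaced by products of factors H + b, and comparing weights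
    by coprimality of such products. *)

Lemma exprS_mx m (N : 'M[k]_m) j : N ^+ j.+1 = N *m N ^+ j.
Proof. exact: exprS. Qed.

Lemma exprSr_mx m (N : 'M[k]_m) j : N ^+ j.+1 = N ^+ j *m N.
Proof. exact: exprSr. Qed.

Lemma exprD_mx m (N : 'M[k]_m) i j : N ^+ (i + j) = N ^+ i *m N ^+ j.
Proof. exact: exprD. Qed.

Lemma expr0_mx m (N : 'M[k]_m) : N ^+ 0 = 1%:M.
Proof. exact: expr0. Qed.

Lemma comm_expr_mx m (N e : 'M[k]_m) j :
  e *m N = N *m e -> e *m N ^+ j = N ^+ j *m e.
Proof. by move=> eN; apply: (@commrX _ e N j). Qed.

Definition shift_mx d : 'M[k]_d := \matrix_(a, b) (a.+1 == b)%:R.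

(** Parity in the basis of a homogeneous chain, up to one global sign: for an odd [N] the parities
    alternate. *)
Definition sign_mx d : 'M[k]_d := diag_mx (\row_(a < d) (-1) ^+ a).

(** The vectors run from [N^(d-1) v] back to [v], the covectors from [phi] on: in this order the
    families are dual index by index, and [N] becomes the same [shift_mx d] on both sides. *)
Definition chain_cols m (N : 'M[k]_m) d (v : 'cV[k]_m) : 'M[k]_(m, d) :=
  \matrix_(i, b) (N ^+ (d - b.+1) *m v) i 0.

Definition chain_rows m (N : 'M[k]_m) d (phi : 'rV[k]_m) : 'M[k]_(d, m) :=
  \matrix_(a, j) (phi *m N ^+ a) 0 j.

(** A Jordan chain [v, N v, ..., N^(d-1) v] together with a covector [phi]
    for which [phi N^(d-1), ..., phi N, phi] is the dual chain. *)
Definition is_chain m (N : 'M[k]_m) d (v : 'cV[k]_m) (phi : 'rV[k]_m) :=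
  [/\ (0 < d)%N, N ^+ d *m v = 0, phi *m N ^+ d = 0 &
      forall j, phi *m N ^+ j *m v = (j.+1 == d)%:R%:M].

Section OneChain.
Variables (m : nat) (N : 'M[k]_m) (d : nat) (v : 'cV[k]_m) (phi : 'rV[k]_m).
Hypothesis ch : is_chain N d v phi.
Let Q := chain_cols N d v.
Let R := chain_rows N d phi.

Lemma col_chain_cols b : col b Q = N ^+ (d - b.+1) *m v.
Proof. by apply/colP=> i; rewrite !mxE. Qed.

Lemma row_chain_rows a : row a R = phi *m N ^+ a.
Proof. by apply/rowP=> i; rewrite !mxE. Qed.

Lemma chain_rows_cols : R *m Q = 1%:M.
Proof.
case: ch => _ _ _ H; apply/matrixP=> a b.
have -> : (R *m Q) a b = (row a R *m col b Q) 0 0.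
  by rewrite !mxE; apply: eq_bigr => i _; rewrite !mxE.
rewrite row_chain_rows col_chain_cols mulmxA -(mulmxA phi) -exprD_mx H !mxE eqxx.
rewrite mulr1n -val_eqE /=; congr (nat_of_bool _)%:R; have := ltn_ord b; have := ltn_ord a; lia.
Qed.

Lemma mul_chain_cols : N *m Q = Q *m shift_mx d.
Proof.
case: ch => d0 Nv _ _; apply/matrixP=> i b.
have -> : (N *m Q) i b = (N *m col b Q) i 0.
  by rewrite !mxE; apply: eq_bigr => j _; rewrite !mxE.
rewrite col_chain_cols mulmxA -exprS_mx [RHS]mxE.
case: b => [[|b] bd] /=.
  by rewrite subn1 prednK // Nv !mxE big1 // => a _; rewrite !mxE mulr0.
rewrite (bigD1 (Ordinal (ltnW bd))) //= big1 => [|a neqa]; last first.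
  rewrite [shift_mx d a _]mxE /= eqSS; move: neqa.
  by rewrite -val_eqE => /= /negPf ->; rewrite mulr0.
by rewrite !mxE /= eqxx mulr1 addr0 subnSK.
Qed.

Lemma chain_rows_mul : R *m N = shift_mx d *m R.
Proof.
case: ch => d0 _ phiN _; apply/row_matrixP => a; rewrite row_mul row_chain_rows.
rewrite -mulmxA -exprSr_mx row_mul [RHS]mulmx_sum_row.
case: (ltnP a.+1 d) => [ad|da].
  rewrite (bigD1 (Ordinal ad)) //= big1 => [|b neqb]; last first.
    by rewrite !mxE /= eq_sym; move: neqb; rewrite -val_eqE => /= /negPf ->; rewrite scale0r.
  by rewrite !mxE /= eqxx scale1r addr0 row_chain_rows.
have E : a.+1 = d by apply/anti_leq; rewrite da ltn_ord.
rewrite [N ^+ a.+1](congr1 (fun j => N ^+ j) E) phiN big1 // => b _; rewrite !mxE.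
by rewrite E gtn_eqF ?scale0r.
Qed.

Lemma expr_chain_cols : N ^+ d *m Q = 0.
Proof.
case: ch => _ Nv _ _; apply/matrixP=> i b.
have -> : (N ^+ d *m Q) i b = (N ^+ d *m col b Q) i 0.
  by rewrite !mxE; apply: eq_bigr => j _; rewrite !mxE.
by rewrite col_chain_cols mulmxA -exprD_mx addnC exprD_mx -mulmxA Nv mulmx0 !mxE.
Qed.

Lemma mul_chain_colsl (e : 'M[k]_m) : e *m N = N *m e -> e *m v = v -> e *m Q = Q.
Proof.
move=> eN ev; apply/matrixP=> i b.
have -> : (e *m Q) i b = (e *m col b Q) i 0.
  by rewrite !mxE; apply: eq_bigr => j _; rewrite !mxE.
by rewrite col_chain_cols mulmxA comm_expr_mx // -mulmxA ev !mxE.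
Qed.

Lemma mul_chain_rowsr (e : 'M[k]_m) : e *m N = N *m e -> phi *m e = phi -> R *m e = R.
Proof.
move=> eN phie; apply/row_matrixP => a; rewrite row_mul row_chain_rows -mulmxA.
by rewrite -comm_expr_mx // mulmxA phie.
Qed.

(** [eps] is the parity sign of [N^(d-1) v], which is column 0; the factor (-1)^(d-1) carries it
    back to [v]. *)
Lemma mul_chain_cols_sign (G : 'M[k]_m) eps : G *m N = - (N *m G) ->
  G *m v = (eps * (-1) ^+ d.-1) *: v -> G *m Q = eps *: (Q *m sign_mx d).
Proof.
move=> GN Gv; case: ch => d0 _ _ _.
have GX j : G *m N ^+ j = (-1) ^+ j *: (N ^+ j *m G).
  elim: j => [|j IH]; first by rewrite !expr0_mx mulmx1 mul1mx expr0 scale1r.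
  rewrite exprS_mx mulmxA GN mulNmx -(mulmxA N G) IH -scalemxAr (mulmxA N).
  by rewrite exprS mulN1r scaleNr.
apply/matrixP=> i b.
have -> : (G *m Q) i b = (G *m col b Q) i 0.
  by rewrite !mxE; apply: eq_bigr => j _; rewrite !mxE.
rewrite col_chain_cols mulmxA GX -scalemxAl -mulmxA Gv -scalemxAr scalerA mxE.
rewrite mul_mx_diag !mxE mulrCA -!mulrA; congr (_ * _).
rewrite mulrA -exprD mulrC; congr (_ * _).
rewrite -[LHS]signr_odd -[RHS]signr_odd.
suff -> : odd (d - b.+1 + d.-1) = odd b by [].
by have := ltn_ord b; lia.
Qed.

Lemma chain_rows_sign (G : 'M[k]_m) eps : G *m N = - (N *m G) ->
  phi *m G = eps *: phi -> R *m G = eps *: (sign_mx d *m R).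
Proof.
move=> GN phiG.
have GX j : N ^+ j *m G = (-1) ^+ j *: (G *m N ^+ j).
  elim: j => [|j IH]; first by rewrite !expr0_mx mulmx1 mul1mx expr0 scale1r.
  rewrite exprSr_mx -mulmxA.
  have -> : N *m G = - (G *m N) by rewrite GN opprK.
  rewrite mulmxN (mulmxA _ G) IH -scalemxAl -(mulmxA G).
  by rewrite exprS mulN1r scaleNr.
apply/row_matrixP => a; rewrite row_mul row_chain_rows -mulmxA GX -scalemxAr mulmxA phiG.
apply/rowP => j; rewrite -scalemxAl mul_diag_mx !mxE.
by rewrite mulrCA.
Qed.

End OneChain.

(* Starting from any functional that is 1 on N^(d-1) v, correct it degree by
   degree so that it vanishes on N^j v for j < d - 1. *)
Lemma dual_covector m (N e : 'M[k]_m) d (v : 'cV[k]_m) :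
    e *m N = N *m e -> e *m e = e -> N ^+ d.+1 *m e = 0 -> e *m v = v ->
    N ^+ d *m v != 0 ->
  exists phi, is_chain N d.+1 v phi /\ phi *m e = phi.
Proof.
move=> eN ee Ne ev Ndv.
have N0v j : (d < j)%N -> N ^+ j *m v = 0.
  move=> dj; rewrite -(subnK dj) exprD_mx -ev mulmxA -(mulmxA (_ ^+ _)) Ne.
  by rewrite mulmx0 mul0mx.
(* Induction on the second [d] of [d - d]: with [t] in its place, the pairings are correct in
   degrees j >= d - t. *)
suff [phi [phie H]] : exists phi : 'rV_m, phi *m e = phi /\
    forall j, (d - d <= j)%N -> phi *m N ^+ j *m v = (j == d)%:R%:M.
  exists phi; split=> //; split=> //; first exact: N0v.
    by rewrite -phie -mulmxA comm_expr_mx // Ne mulmx0.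
  by move=> j; rewrite H ?subnn // eqSS.
elim: {2}d => [|t [phi [phie H]]].
  have [i ni] : exists i, (N ^+ d *m v) i 0 != 0.
    apply/existsP; apply: contraR Ndv => /existsPn H; apply/eqP/colP => i.
    by rewrite [RHS]mxE; apply/eqP; rewrite -[_ == _]negbK H.
  exists ((((N ^+ d *m v) i 0)^-1 *: delta_mx 0 i) *m e); split.
    by rewrite -mulmxA ee.
  move=> j; rewrite subn0 leq_eqVlt => /orP[/eqP <-|dj].
    rewrite eqxx -!mulmxA (mulmxA e) comm_expr_mx // -mulmxA ev -scalemxAl.
    rewrite -rowE; apply/matrixP => a b; rewrite !ord1 mxE [row _ _ _ _]mxE.
    by rewrite mulVf // mxE eqxx.
  rewrite -!mulmxA (mulmxA e) comm_expr_mx // -mulmxA ev.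
  by rewrite (N0v j) // mulmx0 gtn_eqF // raddf0.
have [td|dt] := leqP d t.
  exists phi; split=> // j _; apply: H; lia.
(* The wrong value in degree d - t - 1. There [phi N^(t+1)] takes the value 1, and in all higher
   degrees 0, so the degrees already settled are not disturbed. *)
pose c := (phi *m N ^+ (d - t.+1) *m v) 0 0.
exists (phi - c *: (phi *m N ^+ t.+1)); split.
  by rewrite mulmxBl phie -scalemxAl -mulmxA -comm_expr_mx // mulmxA phie.
move=> j jd; rewrite !mulmxBl -!scalemxAl -(mulmxA phi (_ ^+ t.+1)) -exprD_mx.
rewrite (H (t.+1 + j)%N); last by lia.
have [E|NE] := eqVneq j (d - t.+1)%N.
  rewrite E (_ : (t.+1 + _ == d)%N = true); last by lia.
  rewrite (_ : (_ == d) = false); last by lia.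
  by rewrite [_ *m v]mx11_scalar -/c scalemx1 subrr raddf0.
rewrite H; last by lia.
rewrite (_ : (t.+1 + _ == d)%N = false); last by lia.
by rewrite raddf0 scaler0 subr0.
Qed.

Lemma ex_nilpotency_degree m r (N : 'M[k]_m) (e : 'M[k]_(m, r)) j :
  e != 0 -> N ^+ j *m e = 0 ->
  exists d, N ^+ d.+1 *m e = 0 /\ N ^+ d *m e != 0.
Proof.
move=> e0; elim: j => [|j IH]; first by rewrite expr0_mx mul1mx => /eqP; rewrite (negPf e0).
have [/IH//|ne] := eqVneq (N ^+ j *m e) 0.
by exists j.
Qed.

Lemma mulmx_col_neq0 m p (A : 'M[k]_(m, p)) : A != 0 -> exists v : 'cV_p, A *m v != 0.
Proof.
move=> A0; suff /existsP [j Aj] : [exists j, col j A != 0].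
  by exists (delta_mx j 0); rewrite -colE.
apply: contraR A0 => /existsPn H; apply/eqP/matrixP => i j.
by have /negbNE/eqP/colP/(_ i) := H j; rewrite !mxE.
Qed.

(** The nilpotency degree is taken on the whole image of [e]: the dual covector is built from a
    power of [N] that kills all of it, so the chain is chosen of maximal length there. *)
Lemma ex_chain m (N e : 'M[k]_m) j :
    e *m N = N *m e -> e *m e = e -> e != 0 -> N ^+ j *m e = 0 ->
  exists d v phi, [/\ is_chain N d v phi, e *m v = v & phi *m e = phi].
Proof.
move=> eN ee e0 Nj; have [d [N0 Nd]] := ex_nilpotency_degree e0 Nj.
have [v vn] := mulmx_col_neq0 Nd.
have ev : e *m (e *m v) = e *m v by rewrite mulmxA ee.
have [|phi [ch phie]] := @dual_covector m N e d (e *m v) eN ee N0 ev.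
  by rewrite mulmxA.
by exists d.+1, (e *m v), phi.
Qed.

End Chains.

Lemma natr_inj (k : fieldType) : [pchar k] =i pred0 ->
  injective (fun n : nat => n%:R : k).
Proof.
move=> /pcharf0P k0 a b; wlog ab : a b / (a <= b)%N => [H E|/eqP].
  by case: (leqP a b) => [/H|/ltnW/H] ->.
rewrite eq_sym -subr_eq0 -natrB // k0 subn_eq0 => ba.
by apply/anti_leq; rewrite ab.
Qed.

(** * Splitting a nilpotent matrix into chains *)

Section ChainDecomposition.
Variable k : fieldType.

Section Projection.
Variables (m : nat) (N : 'M[k]_m) (d : nat) (v : 'cV[k]_m) (phi : 'rV[k]_m).
Hypothesis ch : is_chain N d v phi.
Let Q := chain_cols N d v.
Let R := chain_rows N d phi.

Lemma chain_proj_idem : Q *m R *m (Q *m R) = Q *m R.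
Proof. by rewrite mulmxA -(mulmxA Q) (chain_rows_cols ch) mulmx1. Qed.

Lemma chain_proj_comm : Q *m R *m N = N *m (Q *m R).
Proof. by rewrite -mulmxA (chain_rows_mul ch) !mulmxA (mul_chain_cols ch). Qed.

Lemma chain_proj_trace : \tr (Q *m R) = d%:R.
Proof. by rewrite mxtrace_mulC (chain_rows_cols ch) mxtrace1. Qed.

End Projection.

(** Splitting off one chain leaves [e - Q R], again an idempotent commuting with [N], of smaller
    rank. Allowing an arbitrary idempotent [e] makes the induction close. *)
Lemma chain_decomposition m (N e : 'M[k]_m) j :
    e *m N = N *m e -> e *m e = e -> N ^+ j *m e = 0 ->
  exists (ms : seq nat) (v : nat -> 'cV[k]_m) (phi : nat -> 'rV[k]_m),
    (forall i, (i < size ms)%N -> is_chain N (nth 0%N ms i) (v i) (phi i)) /\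
    \sum_(i < size ms) chain_cols N (nth 0%N ms i) (v i) *m
      chain_rows N (nth 0%N ms i) (phi i) = e.
Proof.
have [r] := ubnP (\rank e); elim: r e => // r IH e; rewrite ltnS => re eN ee Nj.
have [->|e0] := eqVneq e 0.
  by exists [::], (fun=> 0), (fun=> 0); split=> //; rewrite big_ord0.
have [d [v [phi [ch ev phie]]]] := ex_chain eN ee e0 Nj.
set Q := chain_cols N d v; set R := chain_rows N d phi.
have eQ : e *m Q = Q by apply: mul_chain_colsl.
have Re : R *m e = R by apply: mul_chain_rowsr.
have RQ : R *m Q = 1%:M := chain_rows_cols ch.
pose e' := e - Q *m R.
have e'e : e' *m e = e' by rewrite mulmxBl ee -mulmxA Re.
have e'Q : e' *m Q = 0 by rewrite mulmxBl eQ -mulmxA RQ mulmx1 subrr.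
have e'e' : e' *m e' = e' by rewrite {2}/e' mulmxBr e'e mulmxA e'Q mul0mx subr0.
have e'N : e' *m N = N *m e'.
  by rewrite mulmxBl mulmxBr eN (chain_proj_comm ch).
have ee' : e *m e' = e' by rewrite mulmxBr ee mulmxA eQ.
have lt : (\rank e' < \rank e)%N.
  apply: rank_ltmx; rewrite ltmxE -{1}e'e submxMl /=.
  apply/negP => /submxP [D eD].
  have Q0 : Q = 0 by rewrite -eQ eD -mulmxA e'Q mulmx0.
  have d0 : (0 < d)%N by case: ch.
  have /matrixP/(_ (Ordinal d0) (Ordinal d0)) := RQ.
  by rewrite Q0 mulmx0 !mxE eqxx => /eqP; rewrite eq_sym oner_eq0.
have [|ms [vs [phis [chs E]]]] := IH e' (leq_trans lt re) e'N e'e'.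
  by rewrite -ee' mulmxA Nj mul0mx.
exists (d :: ms), (fun i => if i is i'.+1 then vs i' else v),
  (fun i => if i is i'.+1 then phis i' else phi); split.
  by case=> [|i] //=; rewrite ltnS; apply: chs.
by rewrite /= big_ord_recl /= E addrC subrK.
Qed.

(* The chain covectors form the base change; the trace of 1 counts its rows. *)
Lemma jordan_form m (N : 'M[k]_m) j : [pchar k] =i pred0 -> N ^+ j = 0 ->
  exists ms : seq nat, has_jordan_blocks N ms /\
    forall d, d \in ms -> exists v phi, is_chain N d v phi.
Proof.
move=> k0 Nj; have [ms [v [phi [ch E]]]] : exists (ms : seq nat) v phi,
    (forall i, (i < size ms)%N -> is_chain N (nth 0%N ms i) (v i) (phi i)) /\
    \sum_(i < size ms) chain_cols N (nth 0%N ms i) (v i) *m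
      chain_rows N (nth 0%N ms i) (phi i) = 1%:M.
  by apply: (@chain_decomposition m N _ j); rewrite ?mulmx1 ?mul1mx.
exists ms; split; last first.
  by move=> d /(nthP 0%N) [i si <-]; exists (v i), (phi i); apply: ch.
pose P := \mxcol_(i < size ms) chain_rows N (nth 0%N ms i) (phi i).
pose Q := \mxrow_(i < size ms) chain_cols N (nth 0%N ms i) (v i).
have QP : Q *m P = 1%:M by rewrite mul_mxrow_mxcol.
have sz : (\sum_(i < size ms) nth 0 ms i)%N = m.
  have : \tr (Q *m P) = m%:R by rewrite QP mxtrace1.
  rewrite mul_mxrow_mxcol raddf_sum /=.
  rewrite (eq_bigr (fun i : 'I__ => (nth 0 ms i)%:R)) => [|i _]; last first.
    exact/chain_proj_trace/ch/ltn_ord.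
  by rewrite -natr_sum => /(natr_inj k0).
exists P; split.
- rewrite /row_free eqn_leq rank_leq_row /= {1}sz.
  by rewrite -{1}(mxrank1 k m) -QP mxrankM_maxr.
- by rewrite /row_full eqn_leq rank_leq_col /= -{1}(mxrank1 k m) -QP mxrankM_maxr.
- rewrite mul_mxdiag_mxcol mxcol_mul; apply/eq_mxcolP => i.
  exact/chain_rows_mul/ch/ltn_ord.
Qed.

End ChainDecomposition.

(** * Triangularization and generalized eigenprojections *)

Lemma trigonalizable (k : closedFieldType) n (Z : 'M[k]_n) :
  exists P P' : 'M[k]_n, P *m P' = 1%:M /\ is_trig_mx (P *m Z *m P').
Proof.
elim: n Z => [|n IH] Z.
  by exists 1%:M, 1%:M; rewrite mulmx1; split=> //; apply/is_trig_mxP; case.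
have /closed_rootP [a] : size (char_poly Z) != 1 by rewrite size_char_poly.
rewrite -eigenvalue_root_char => /eigenvalueP [v vZ v0].
(* As [v] has rank one, the first row of this invertible matrix is proportional to [v]; conjugation
   by it clears the first row of [Z] off the diagonal, and induction treats the lower right
   block. *)
pose E := row_ebase v.
have Eu : E \in unitmx := row_ebase_unit v.
have [c c0 vE] : exists2 c, c != 0 & v = c *: row 0 E.
  exists (col_ebase v 0 0).
    have := col_ebase_unit v; rewrite unitmxE [col_ebase v]mx11_scalar det_scalar1.
    by rewrite unitfE mxE eqxx.
  rewrite -{1}(mulmx_ebase v) rank_rV v0 {1}[col_ebase v]mx11_scalar -mulmxA mul_scalar_mx.
  congr (_ *: _); rewrite rowE; congr (_ *m _); apply/rowP => j; rewrite !mxE /=.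
  by rewrite andbT eq_sym.
have EZ : row 0 E *m Z = a *: row 0 E.
  by apply: (scalerI c0); rewrite scalemxAl -vE vZ vE scalerA mulrC -scalerA.
pose W : 'M_(1 + n) := E *m Z *m invmx E.
have W0 : row 0 W = a *: delta_mx 0 0.
  rewrite /W -mulmxA row_mul mulmxA EZ -scalemxAl -row_mul mulmxV //.
  by rewrite row1.
have ur : ursubmx W = 0.
  move: (W) W0 => W' /rowP W'0; apply/matrixP=> i j.
  move: (W'0 (rshift 1 j)); rewrite !mxE !ord1 /= mulr0 => <-.
  by congr (W' _ _); apply/val_inj.
have [P [P' [PP' Pt]]] := IH (drsubmx W).
pose D : 'M_(1 + n) := block_mx 1%:M 0 0 P.
pose D' : 'M_(1 + n) := block_mx 1%:M 0 0 P'.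
have simp := (mul1mx, mulmx1, mul0mx, mulmx0, addr0, add0r).
have DD' : D *m D' = 1%:M.
  by rewrite mulmx_block !simp PP' -scalar_mx_block.
have DWD' : D *m W *m D' = block_mx (ulsubmx W) 0 (P *m dlsubmx W) (P *m drsubmx W *m P').
  by rewrite -{1}(submxK W) ur !mulmx_block !simp.
exists (D *m E), (invmx E *m D'); split.
  by rewrite mulmxA mulmxK.
rewrite !mulmxA -(mulmxA D) -(mulmxA D) -/W.
have : is_trig_mx (D *m W *m D') by rewrite DWD' is_trig_block_mx // eqxx mx11_is_trig.
by [].
Qed.

(* The idempotent is a polynomial in Z, hence shares every property of k[Z]
   that is inductive along Horner's scheme. *)
Lemma generalized_eigenprojection (k : closedFieldType) n (Z : 'M[k]_n) :
    (0 < n)%N ->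
  exists (a : k) (m : nat) (e : 'M[k]_n),
    [/\ e *m e = e, e != 0, (Z - a%:M) ^+ m *m e = 0 &
        forall K : 'M[k]_n -> Prop, (K 0) ->
          (forall A c, K A -> K (A *m Z + c%:M)) -> K e].
Proof.
case: n Z => // n Z _.
have /closed_rootP [a ra] : size (char_poly Z) != 1 by rewrite size_char_poly.
have [m [q /implyP nq E]] := multiplicity_XsubC (char_poly Z) a.
have {}nq : ~~ root q a by apply/nq/monic_neq0/char_poly_monic.
have cop : coprimep (('X - a%:P) ^+ m) q.
  by apply: coprimep_expl; rewrite coprimep_sym coprimep_XsubC.
(* With u (X - a)^m + w q = 1 the idempotent is (w q)(Z): by Cayley-Hamilton it annihilates the
   other summand. *)
have /Bezout_eq1_coprimepP [[u w] /= uw] := cop.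
have ZC : horner_mx Z ('X - a%:P) = Z - a%:M.
  by rewrite rmorphB /= horner_mx_X horner_mx_C.
have CH : horner_mx Z (w * q) *m horner_mx Z (('X - a%:P) ^+ m) = 0.
  by rewrite mulmxE -rmorphM -mulrA -E rmorphM /= Cayley_Hamilton mulr0.
have one : horner_mx Z u *m horner_mx Z (('X - a%:P) ^+ m) + horner_mx Z (w * q) = 1%:M.
  by rewrite mulmxE -rmorphM -rmorphD uw rmorph1.
have C p r : horner_mx Z p *m horner_mx Z r = horner_mx Z r *m horner_mx Z p.
  exact: comm_horner_mx2.
have e1 A : A = A *m horner_mx Z u *m horner_mx Z (('X - a%:P) ^+ m) + A *m horner_mx Z (w * q).
  by rewrite -mulmxA -mulmxDr one mulmx1.
exists a, m, (horner_mx Z (w * q)); split.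
- by rewrite [RHS]e1 (C _ u) -(mulmxA _ (horner_mx Z (w * q))) CH mulmx0 add0r.
- apply/eqP => e0; move: one; rewrite e0 addr0 => uX.
  have : eigenvalue Z a by rewrite eigenvalue_root_char.
  case/eigenvalueP => v vZ v0; case/eqP: v0.
  have va : v *m (Z - a%:M) = 0 by rewrite mulmxBr vZ mul_mx_scalar subrr.
  have m0 : (0 < m)%N.
    by rewrite lt0n; apply: contraNneq nq => m0; rewrite E m0 mulr1 in ra.
  rewrite -(mulmx1 v) -uX C mulmxA rmorphXn /= ZC.
  by rewrite -(prednK m0) exprS_mx mulmxA va !mul0mx.
- by rewrite -[RHS]CH -ZC -rmorphXn /=; apply: C.
- move=> K K0 KS; elim/poly_ind: (w * q) => [|p c IH]; first by rewrite rmorph0.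
  by rewrite rmorphD rmorphM /= horner_mx_X horner_mx_C; apply: KS.
Qed.

(** * Parity and the even part of sl(n|n) *)

Section Parity.
Local Arguments mxhom : simpl never.
Variables (k : fieldType) (p q : nat).
Hypothesis two_neq0 : 2%:R != 0 :> k.
Implicit Types A B : 'M[k]_(p + q).

(** Even and odd become commuting and anticommuting with this operator, and the supertrace becomes a
    trace against it, so that block computations reduce to associativity. *)
Definition parity_mx : 'M[k]_(p + q) := block_mx 1%:M 0 0 (- 1%:M).
Notation G := parity_mx.

Let simp := (mulNmx, mulmxN, mul1mx, mulmx1, mul0mx, mulmx0, oppr0, addr0, add0r).

Lemma parity_mxK : G *m G = 1%:M.
Proof. by rewrite mulmx_block !simp opprK -scalar_mx_block. Qed.

Lemma eq_oppmx m1 m2 (A : 'M[k]_(m1, m2)) : A = - A -> A = 0.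
Proof.
move=> /matrixP E; apply/matrixP => i j; rewrite mxE.
have /eqP := E i j; rewrite mxE -addr_eq0 -mulr2n -mulr_natr mulf_eq0.
by rewrite (negPf two_neq0) orbF => /eqP.
Qed.

Lemma glpart_even A : A \in glpart k p q false <-> G *m A = A *m G.
Proof.
rewrite memv_ker lfunE /= /mxhom /= -{3 4}[A]submxK !mulmx_block !simp; split.
  rewrite block_mx_eq0 => /and4P[_ /eqP-> /eqP-> _].
  by rewrite !simp.
case/eq_block_mx => _ ur /esym dl _.
by rewrite (eq_oppmx ur) (eq_oppmx dl) block_mx0.
Qed.

Lemma glpart_odd A : A \in glpart k p q true <-> G *m A = - (A *m G).
Proof.
rewrite memv_ker lfunE /= /mxhom /= -{3 4}[A]submxK !mulmx_block !simp opp_block_mx; split.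
  rewrite block_mx_eq0 => /and4P[/eqP-> _ _ /eqP->].
  by rewrite !simp !opprK.
case/eq_block_mx => ul _ _ /esym dr; rewrite opprK in dr.
by rewrite (eq_oppmx ul) (eq_oppmx dr) block_mx0.
Qed.

Lemma mxhom_even b A : G *m A = A *m G -> mxhom b A = if b then 0 else A.
Proof.
move=> /glpart_even; rewrite memv_ker lfunE /= /mxhom /= => E.
case: b; first exact/eqP.
by move: E => /=; rewrite block_mx_eq0 -{5}[A]submxK => /and4P[_ /eqP-> /eqP-> _].
Qed.

Lemma mxhom_odd b A : G *m A = - (A *m G) -> mxhom b A = if b then A else 0.
Proof.
move=> /glpart_odd; rewrite memv_ker lfunE /= /mxhom /= => E.
case: b; last exact/eqP.
by move: E => /=; rewrite block_mx_eq0 -{5}[A]submxK => /and4P[/eqP-> _ _ /eqP->].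
Qed.

Lemma mxhomD A : mxhom false A + mxhom true A = A.
Proof. by rewrite /mxhom add_block_mx !simp submxK. Qed.

Lemma sbr_even A B : G *m A = A *m G -> sbr A B = A *m B - B *m A.
Proof.
move=> eA; rewrite /sbr !big_bool /=.
have -> : mxhom true A = 0 := mxhom_even true eA.
have -> : mxhom false A = A := mxhom_even false eA.
rewrite !mul0mx !mulmx0 !scaler0 !subr0 !expr0 !scale1r !add0r.
by rewrite addrACA -opprD -mulmxDl -mulmxDr addrC [mxhom true _ + _]addrC mxhomD addrC.
Qed.

Lemma sbr_odd A B : G *m A = - (A *m G) -> G *m B = - (B *m G) ->
  sbr A B = A *m B + B *m A.
Proof.
move=> oA oB; rewrite /sbr !big_bool /=.
have -> : mxhom true A = A := mxhom_odd true oA.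
have -> : mxhom false A = 0 := mxhom_odd false oA.
have -> : mxhom true B = B := mxhom_odd true oB.
have -> : mxhom false B = 0 := mxhom_odd false oB.
by rewrite !mul0mx !mulmx0 !scaler0 !subr0 !addr0 expr1 scaleN1r opprK.
Qed.

Lemma str_parity A : str A = \tr (G *m A).
Proof.
by rewrite -{2}[A]submxK mulmx_block !simp mxtrace_block raddfN.
Qed.

Lemma even_mul A B : G *m A = A *m G -> G *m B = B *m G ->
  G *m (A *m B) = A *m B *m G.
Proof. by move=> eA eB; rewrite mulmxA eA -mulmxA eB mulmxA. Qed.

Lemma odd_mul A B : G *m A = - (A *m G) -> G *m B = - (B *m G) ->
  G *m (A *m B) = A *m B *m G.
Proof. by move=> oA oB; rewrite mulmxA oA mulNmx -(mulmxA A G) oB mulmxN opprK mulmxA. Qed.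

Lemma str_mulC A B : G *m A = A *m G -> str (A *m B) = str (B *m A).
Proof. by move=> eA; rewrite !str_parity mulmxA eA -mulmxA mxtrace_mulC -mulmxA. Qed.

End Parity.

Local Notation G := (parity_mx _ _ _).

Lemma free_subseq (k : fieldType) (vT : vectType k) (X : seq vT) :
  exists2 Y, {subset Y <= X} & free Y /\ <<Y>>%VS = <<X>>%VS.
Proof.
elim: X => [|x X [Y YX [fY sY]]]; first by exists [::]; rewrite // nil_free.
have [xY|xY] := boolP (x \in <<Y>>%VS).
  exists Y; first by move=> y /YX; rewrite inE orbC => ->.
  by split=> //; rewrite span_cons sY; apply/esym/addv_idPr; rewrite -memvE -sY.
exists (x :: Y); last by rewrite free_cons xY fY !span_cons sY.
by move=> y; rewrite !inE => /orP[->//|/YX->]; rewrite orbT.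
Qed.

(** [semisimple] asks for a basis of eigenvectors. Writing each element as a sum of eigenvectors is
    enough, since a basis can be extracted from a spanning family. *)
Lemma basis_of_spanning (k : fieldType) (vT : vectType k) (W : {vspace vT})
    (P : vT -> Prop) :
    (forall w, w \in W -> exists2 s : seq vT,
       (forall z, z \in s -> z \in W /\ P z) & w = \sum_(z <- s) z) ->
  exists2 X : seq vT, basis_of W X & forall z, z \in X -> P z.
Proof.
move=> H.
have [s sW Ws] : exists2 s : seq vT, (forall z, z \in s -> z \in W /\ P z) &
    {subset (vbasis W : seq vT) <= <<s>>%VS}.
  have : {subset (vbasis W : seq vT) <= W} by move=> z /vbasis_mem.
  elim: (vbasis W : seq vT) => [|w X IH] XW.
    by exists [::] => z; rewrite in_nil.
  have [s1 sW1 Ws1] : exists2 s : seq vT, (forall z, z \in s -> z \in W /\ P z) &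
      {subset X <= <<s>>%VS}.
    by apply: IH => z zX; apply: XW; rewrite inE zX orbT.
  have [s2 sW2 E] := H w (XW w (mem_head _ _)).
  exists (s1 ++ s2); first by move=> z; rewrite mem_cat => /orP[/sW1|/sW2].
  move=> z; rewrite inE span_cat => /orP[/eqP->|/Ws1 zs1].
    rewrite E; apply: (subvP (addvSr _ _)).
    by rewrite big_seq; apply: memv_suml => y /memv_span.
  exact: (subvP (addvSl _ _)).
have [Y Ys [fY sY]] := free_subseq s.
exists Y; last by move=> z /Ys/sW [].
rewrite /basis_of fY sY andbT eqEsubv -{2}(span_basis (vbasisP W)).
by apply/andP; split; apply/span_subvP => // z /sW [].
Qed.

(** * Semisimple elements and the center of g0 *)

Section SL.
Variables (k : fieldType) (n : nat).
Hypothesis k0 : [pchar k] =i pred0.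
Hypothesis n_gt0 : (0 < n)%N.
Implicit Types x y z : 'M[k]_(n + n).

Let two_neq0 : 2%:R != 0 :> k.
Proof. by move/pcharf0P: k0 => ->. Qed.

Lemma sl_even z : z \in slpart k n false <-> G *m z = z *m G /\ str z = 0.
Proof.
rewrite memv_cap memv_ker lfunE /=; split.
  by move=> /andP[/eqP ? /glpart_even] => /(_ two_neq0).
by move=> [? ->]; rewrite eqxx; apply/glpart_even.
Qed.

Lemma sl_odd z : z \in slpart k n true <-> G *m z = - (z *m G).
Proof.
rewrite memv_cap memv_ker lfunE /=; split; first by case/andP => _ /glpart_odd; apply.
move=> oz; apply/andP; split; last exact/glpart_odd.
rewrite str_parity; have : \tr (G *m z) = - \tr (G *m z).
  by rewrite {1}oz raddfN /= mxtrace_mulC.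
move/eqP; rewrite -addr_eq0 -mulr2n -mulr_natr mulf_eq0 (negPf two_neq0) orbF.
by [].
Qed.

Lemma sl_part b z : z \in slpart k n b -> z \in sl k n.
Proof. by rewrite memv_cap => /andP[]. Qed.

(** Peirce decomposition: [p i z p j] is an eigenvector of ad y with eigenvalue c i - c j. *)
Lemma semisimple_sum_idem (I : finType) (p : I -> 'M[k]_(n + n)) (c : I -> k) :
    (forall i, G *m p i = p i *m G) ->
    (forall i j, p i *m p j = if i == j then p i else 0) ->
    \sum_i p i = 1%:M -> str (\sum_i c i *: p i) = 0 ->
  semisimple (\sum_i c i *: p i).
Proof.
move=> ep pp p1 sy; set y := \sum_i _.
have ey : G *m y = y *m G.
  by rewrite mulmx_sumr mulmx_suml; apply: eq_bigr => i _; rewrite -scalemxAr ep scalemxAl.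
have yp i : y *m p i = c i *: p i.
  rewrite mulmx_suml (bigD1 i) //= -scalemxAl pp eqxx big1 ?addr0 // => j ji.
  by rewrite -scalemxAl pp (negPf ji) scaler0.
have py i : p i *m y = c i *: p i.
  rewrite mulmx_sumr (bigD1 i) //= -scalemxAr pp eqxx big1 ?addr0 // => j ji.
  by rewrite -scalemxAr pp eq_sym (negPf ji) scaler0.
split; first by apply/sl_even.
apply: basis_of_spanning => z /sl_even [ez sz].
pose t (ij : I * I) := if ij.1 == ij.2 then 0 else p ij.1 *m z *m p ij.2.
(* The diagonal pieces stay together: a single [p i z p i] may have nonzero supertrace, whereas [r]
   differs from [z] only by off-diagonal pieces, of supertrace 0. *)
pose r := \sum_i p i *m z *m p i.
have zE : z = r + \sum_ij t ij.
  transitivity (\sum_i \sum_j p i *m z *m p j).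
    rewrite -{1}(mul1mx z) -(mulmx1 (_ *m z)) -p1 !mulmx_suml.
    by apply: eq_bigr => i _; rewrite mulmx_sumr.
  rewrite -(pair_bigA _ (fun i j => t (i, j))) -big_split /=; apply: eq_bigr => i _.
  rewrite (bigD1 i) //=; congr (_ + _); rewrite [RHS](bigD1 i) //= /t /= eqxx add0r.
  by apply: eq_bigr => j ji; rewrite eq_sym (negPf ji).
have tP ij : t ij \in slpart k n false.
  rewrite /t; case: eqP => [_|ij']; first exact: mem0v.
  apply/sl_even; split; first by rewrite !even_mul.
  rewrite -mulmxA str_mulC // -mulmxA pp.
  by case: eqP => [/esym//|_]; rewrite mulmx0 linear0.
have rE : r = z - \sum_ij t ij by rewrite {1}zE addrK.
exists (r :: [seq t ij | ij <- index_enum _]); last by rewrite big_cons big_map.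
move=> w; rewrite inE => /orP[/eqP->|/mapP [[i j] _ ->]].
  split; first by rewrite rE memvB ?memv_suml //; apply/sl_even.
  exists 0; rewrite scale0r sbr_even //.
  rewrite mulmx_sumr mulmx_suml; apply/eqP; rewrite subr_eq0; apply/eqP/eq_bigr => i _.
  by rewrite !mulmxA yp -!mulmxA py -!scalemxAl -!scalemxAr.
split=> //; exists (c i - c j); rewrite sbr_even //.
rewrite /t /=; case: eqP => _; first by rewrite mulmx0 mul0mx subr0 scaler0.
by rewrite !mulmxA yp -!mulmxA py -!scalemxAl -!scalemxAr scalerBl.
Qed.

Lemma comm_all_scalar m (Z : 'M[k]_m) : (0 < m)%N ->
  (forall C, Z *m C = C *m Z) -> exists a, Z = a%:M.
Proof.
move=> m0 H; exists (Z (Ordinal m0) (Ordinal m0)); apply/matrixP => i j.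
have := H (delta_mx j (Ordinal m0)) => /matrixP/(_ i (Ordinal m0)).
rewrite [LHS]mxE (bigD1 j) //= !mxE !eqxx mulr1 big1 ?addr0 => [->|l lj]; last first.
  by rewrite mxE (negPf lj) mulr0.
rewrite (bigD1 (Ordinal m0)) //= mxE eqxx andbT big1 ?addr0 => [|l lj]; last first.
  by rewrite mxE (negPf lj) andbF mul0r.
by rewrite mulr_natl.
Qed.

(** The matrices diag(C, C) have supertrace 0, so commuting with them makes both blocks of [z]
    scalars a and b; the supertrace of [z] then gives n (a - b) = 0. *)
Lemma central_scalar z : z \in slpart k n false ->
  (forall y, y \in slpart k n false -> z *m y = y *m z) -> exists a, z = a%:M.
Proof.
move=> /sl_even [ez sz] H.
have : z = block_mx (ulsubmx z) 0 0 (drsubmx z).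
  by rewrite -{1}(mxhom_even two_neq0 false ez).
move: (ulsubmx z) (drsubmx z) => z1 z2 zE; rewrite {}zE in ez sz H *.
have HC (C : 'M_n) : z1 *m C = C *m z1 /\ z2 *m C = C *m z2.
  have : block_mx C 0 0 C \in slpart k n false.
    apply/sl_even; split; last by rewrite /str block_mxKul block_mxKdr subrr.
    by rewrite !mulmx_block !(mul0mx, mulmx0, addr0, add0r, mulNmx, mulmxN, mul1mx, mulmx1).
  move/H; rewrite !mulmx_block !(mul0mx, mulmx0, addr0, add0r).
  by case/eq_block_mx.
have [a aE] := comm_all_scalar n_gt0 (fun C => (HC C).1).
have [b bE] := comm_all_scalar n_gt0 (fun C => (HC C).2).
exists a; move: sz; rewrite aE bE /str block_mxKul block_mxKdr !mxtrace_scalar.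
move/eqP; rewrite -mulrnBl -mulr_natr mulf_eq0.
move/pcharf0P: k0 => ->; rewrite eqn0Ngt n_gt0 orbF subr_eq0 => /eqP->.
by rewrite -scalar_mx_block.
Qed.

(** Distinguishedness enters the proof only in this form. *)
Lemma distinguished_comm x y : distinguished x -> semisimple y ->
  y *m x = x *m y -> exists a, y = a%:M.
Proof.
move=> [_ dx] ss yx; have y0 : y \in slpart k n false by case: ss.
have [ey sy] := (sl_even y).1 y0.
have [_ cy] : in_center y by apply: dx => //; rewrite sbr_even // yx subrr.
apply: central_scalar => // z /sl_part /cy.
by rewrite sbr_even // => /eqP; rewrite subr_eq0 => /eqP.
Qed.

End SL.

(** * The square of a distinguished element *)

Section SquareJordan.
Variables (k : closedFieldType) (n : nat).
Hypothesis k0 : [pchar k] =i pred0.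
Hypothesis n_gt0 : (0 < n)%N.
Implicit Types x y z s f : 'M[k]_(n + n).

Let two_neq0 : 2%:R != 0 :> k.
Proof. by move/pcharf0P: k0 => ->. Qed.

Lemma idem_distinguished x e : distinguished x -> G *m e = e *m G ->
  e *m e = e -> str e = 0 -> e *m x = x *m e -> e = 0 \/ e = 1%:M.
Proof.
move=> dx Ge ee se ex.
have E : \sum_(b : bool) (b%:R : k) *: (if b then e else 1%:M - e) = e.
  by rewrite big_bool /= scale1r scale0r addr0.
have [a ea] : exists a, e = a%:M.
  apply: (distinguished_comm k0 n_gt0 dx) => //; rewrite -E; apply: semisimple_sum_idem => //.
  - by case; rewrite // mulmxBr mulmxBl mul1mx mulmx1 Ge.
  - case; case=> /=; rewrite ?(mulmxBr, mulmxBl, mul1mx, mulmx1, ee) ?subrr //.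
    by rewrite subr0.
  - by rewrite big_bool /= addrC subrK.
  - by rewrite E.
have n2 : (0 < n + n)%N by rewrite addn_gt0 n_gt0.
move: ee => /matrixP/(_ (Ordinal n2) (Ordinal n2)); rewrite ea -scalar_mxM !mxE eqxx !mulr1n.
move/eqP; rewrite -subr_eq0 -{3}(mulr1 a) -mulrBr mulf_eq0 subr_eq0.
by case/orP => /eqP ->; [left; rewrite raddf0|right].
Qed.

Lemma half_squareE x : G *m x = - (x *m G) -> half_square x = x *m x.
Proof.
move=> ox; rewrite /half_square sbr_odd // -mulr2n -scaler_nat scalerA mulVf //.
by rewrite scale1r.
Qed.

Lemma str_mul_square x y : G *m x = - (x *m G) -> G *m y = y *m G ->
  y *m x = x *m y -> str (y *m (x *m x)) = 0.
Proof.
move=> ox ey yx; rewrite str_parity.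
have E : \tr (G *m y *m (x *m x)) = - \tr (G *m y *m (x *m x)).
  rewrite {1}mulmxA mxtrace_mulC mulmxA.
  have -> : x *m (G *m y) = - (G *m y *m x).
    by rewrite mulmxA -[x *m G]opprK -ox mulNmx -!mulmxA yx.
  by rewrite mulNmx -!mulmxA raddfN.
move/eqP: E; rewrite -addr_eq0 -mulr2n -mulr_natr mulf_eq0 (negPf two_neq0) orbF.
by move/eqP; rewrite !mulmxA.
Qed.

Lemma distinguished_square x : x \in slpart k n true -> distinguished x ->
  exists a m, (x *m x - a%:M) ^+ m = 0.
Proof.
move=> /(sl_odd k0) ox dx.
have n2 : (0 < n + n)%N by rewrite addn_gt0 n_gt0.
have [a [m [e [ee e0 Ze HK]]]] := generalized_eigenprojection (x *m x) n2.
exists a, m.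
have eG : G *m (x *m x) = x *m x *m G.
  exact: odd_mul.
have [Ge [ex se]] : G *m e = e *m G /\ e *m x = x *m e /\ str e = 0.
  apply: (HK (fun e => G *m e = e *m G /\ e *m x = x *m e /\ str e = 0)).
    by rewrite !mulmx0 !mul0mx linear0.
  move=> A c [GA [Ax sA]]; split; last split.
  - by rewrite mulmxDr mulmxDl (even_mul GA eG) scalar_mxC.
  - by rewrite mulmxDl mulmxDr scalar_mxC !mulmxA Ax.
  - rewrite linearD /= str_mul_square // add0r /str scalar_mx_block.
    by rewrite block_mxKul block_mxKdr subrr.
have [e0'|e1] := idem_distinguished dx Ge ee se ex; first by rewrite e0' eqxx in e0.
by rewrite -[LHS]mulmx1 -e1.
Qed.

(** Induction on the power of [N] killing [z] from the right reduces to [z N = 0]; there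
    [N z = a z], so a^j z = N^j z = 0. *)
Lemma nilpotent_eigen_commutator m (N z : 'M[k]_m) j a : a != 0 -> N ^+ j = 0 ->
  N *m z - z *m N = a *: z -> z = 0.
Proof.
move=> a0 Nj; have : z *m N ^+ j = 0 by rewrite Nj mulmx0.
elim: {1}j z => [|i IH] z; first by rewrite expr0_mx mulmx1.
rewrite exprS_mx mulmxA => zNi E.
have zN : z *m N = 0.
  by apply: IH => //; rewrite mulmxA -mulmxBl E scalemxAl.
have Nz l : N ^+ l *m z = a ^+ l *: z.
  elim: l => [|l IHl]; first by rewrite expr0_mx mul1mx expr0 scale1r.
  have Nz1 : N *m z = a *: z by rewrite -E zN subr0.
  by rewrite exprSr_mx -mulmxA Nz1 -scalemxAr IHl scalerA exprS.
have := Nz j; rewrite Nj mul0mx => /esym/eqP; rewrite scaler_eq0 expf_eq0 (negPf a0) andbF.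
by move/eqP.
Qed.

Lemma trace_nilpotent m (N : 'M[k]_m) j : N ^+ j = 0 -> \tr N = 0.
Proof.
move=> Nj; have [ms [v [phi [ch E]]]] : exists (ms : seq nat) v phi,
    (forall i, (i < size ms)%N -> is_chain N (nth 0%N ms i) (v i) (phi i)) /\
    \sum_(i < size ms) chain_cols N (nth 0%N ms i) (v i) *m
      chain_rows N (nth 0%N ms i) (phi i) = 1%:M.
  by apply: (@chain_decomposition k m N _ j); rewrite ?mulmx1 ?mul1mx.
rewrite -[N]mulmx1 -E mulmx_sumr raddf_sum big1 // => i _.
have chi := ch i (ltn_ord i).
rewrite /= mulmxA (mul_chain_cols chi) -mulmxA mxtrace_mulC -mulmxA.
rewrite (chain_rows_cols chi) mulmx1 /mxtrace big1 // => a _.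
by rewrite mxE eqn_leq ltnn.
Qed.

Lemma trace_der_g0 z : z \in der_g0 k n -> \tr z = 0.
Proof.
move=> zd; suff : (der_g0 k n <= lker (linfun (@mxtrace k (n + n) : _ -> k^o)))%VS.
  by move/subvP/(_ _ zd); rewrite memv_ker lfunE => /eqP.
apply/span_subvP => _ /allpairsP [[u w] /= [/vbasis_mem uW wW ->]].
have [eu _] := (sl_even k0 u).1 uW.
by rewrite memv_ker lfunE /= sbr_even // raddfB /= mxtrace_mulC subrr.
Qed.

(** The decomposition is given through the adjoint action on g0 and has to be identified with x^2 =
    a + nilpotent on V. *)
Lemma distinguished_jordan_dec x s f : x \in slpart k n true -> distinguished x ->
    jordan_dec (half_square x) s f ->
  exists a m, [/\ s = a%:M, f = x *m x - a%:M & f ^+ m = 0].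
Proof.
move=> xodd dx [[s0 [X Xb Xs]] [fd [mf fn]] sf].
have ox := (sl_odd k0 x).1 xodd; rewrite half_squareE // => xx.
have [a [m Nm]] := distinguished_square xodd dx.
have [es ss] := (sl_even k0 s).1 s0.
have Xg0 z : z \in X -> z \in slpart k n false by apply: basis_mem.
have exx : G *m (x *m x) = x *m x *m G.
  exact: odd_mul.
have ef : G *m f = f *m G.
  have -> : f = x *m x - s by rewrite xx addrAC subrr add0r.
  by rewrite mulmxBr mulmxBl es exx.
have {sf}sf : s *m f = f *m s by apply/eqP; rewrite -subr_eq0 -sbr_even // sf.
have sX z : z \in X -> s *m z - z *m s = 0.
  move=> zX; have [c cz] := Xs z zX; have /Xg0 z0 := zX.
  have [ez _] := (sl_even k0 z).1 z0.
  have [c00|c0] := eqVneq c 0.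
    by rewrite -sbr_even // cz c00 scale0r.
  (* Here c != 0. Passing from [z] to [f, z] repeatedly reduces to [f, z] = 0; then the commutator
     with x^2, hence with the nilpotent x^2 - a, has [z] as eigenvector of eigenvalue c. *)
  suff -> : z = 0 by rewrite mulmx0 mul0mx subrr.
  move: cz (fn z z0); rewrite sbr_even //.
  elim: mf z ez {zX z0 fn} => [|j IH] z ez //; rewrite iterSr => cz fz.
  have efz : G *m (sbr f z) = sbr f z *m G.
    by rewrite sbr_even // mulmxBr mulmxBl !even_mul.
  have {IH}fz0 : f *m z - z *m f = 0.
    rewrite -sbr_even //; apply: IH => //.
    have sz : s *m z = c *: z + z *m s by rewrite -cz subrK.
    rewrite sbr_even // mulmxBr mulmxBl !mulmxA sf -(mulmxA f s z) sz mulmxDr.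
    rewrite -scalemxAr mulmxDl -scalemxAl -(mulmxA z s f) sf !mulmxA scalerBr.
    by rewrite opprD addrACA addrK.
  apply: (nilpotent_eigen_commutator c0 Nm).
  rewrite mulmxBl mulmxBr xx mulmxDl mulmxDr (scalar_mxC a) opprB addrA subrK.
  by rewrite -addrA opprD [f *m z + _]addrCA fz0 addr0.
have [b sb] : exists b, s = b%:M.
  apply: central_scalar => // y yg.
  rewrite (@coord_basis _ _ _ _ (in_tuple X) y Xb yg) mulmx_sumr mulmx_suml.
  apply: eq_bigr => i _.
  have iX : X`_i \in X by apply: mem_nth.
  by rewrite -scalemxAr -scalemxAl; congr (_ *: _); apply/eqP; rewrite -subr_eq0 sX.
have fE : f = (x *m x - a%:M) + (a - b)%:M.
  by rewrite xx sb raddfB /= addrA subrK addrAC subrr add0r.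
(* As an element of the derived algebra [f] has trace 0 on V, and so has the nilpotent x^2 - a; what
   remains is 2n (a - b) = 0. *)
have ab : a = b.
  have := trace_der_g0 fd; rewrite fE linearD /= (trace_nilpotent Nm) add0r mxtrace_scalar.
  move/eqP; rewrite -mulr_natr mulf_eq0; move/pcharf0P: k0 => ->.
  by rewrite addn_eq0 eqn0Ngt n_gt0 orbF subr_eq0 => /eqP.
exists b, m; split=> //; rewrite fE ab subrr raddf0 addr0 //.
by rewrite -ab.
Qed.

End SquareJordan.

(** * Dimensions of centralizers *)

Section Centralizers.
Variables (k : closedFieldType) (n : nat).
Hypothesis k0 : [pchar k] =i pred0.
Hypothesis n_gt0 : (0 < n)%N.
Implicit Types z y : 'M[k]_(n + n).

Let two_neq0 : 2%:R != 0 :> k.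
Proof. by move/pcharf0P: k0 => ->. Qed.

Let simp := (mulNmx, mulmxN, mul1mx, mulmx1, mul0mx, mulmx0, oppr0, addr0, add0r).

Lemma even_block (A B : 'M[k]_n) : G *m block_mx A 0 0 B = block_mx A 0 0 B *m G.
Proof. by rewrite !mulmx_block !simp. Qed.

Lemma even_blockP z : G *m z = z *m G -> z = block_mx (ulsubmx z) 0 0 (drsubmx z).
Proof. by move=> ez; rewrite -{1}(mxhom_even two_neq0 false ez). Qed.

Lemma odd_block (A B : 'M[k]_n) : G *m block_mx 0 A B 0 = - (block_mx 0 A B 0 *m G).
Proof. by rewrite !mulmx_block !simp opp_block_mx !simp opprK. Qed.

Lemma even_entries z :
  (forall i j, z (lshift n i) (rshift n j) = 0 /\ z (rshift n j) (lshift n i) = 0) <->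
  G *m z = z *m G.
Proof.
split=> [H|/even_blockP -> i j]; last by rewrite block_mxEur block_mxEdl !mxE.
rewrite -[z]submxK.
have -> : ursubmx z = 0 by apply/matrixP => i j; rewrite !mxE; case: (H i j).
have -> : dlsubmx z = 0 by apply/matrixP => i j; rewrite !mxE; case: (H j i).
exact: even_block.
Qed.

Lemma trig_comm_diag m (A B : 'M[k]_m) (i j : 'I_m) : is_trig_mx A -> is_trig_mx B ->
  (i <= j)%N -> (A *m B - B *m A) i j = 0.
Proof.
move=> /is_trig_mxP tA /is_trig_mxP tB.
have E (C D : 'M[k]_m) : (forall i j : 'I_m, (i < j)%N -> C i j = 0) ->
    (forall i j : 'I_m, (i < j)%N -> D i j = 0) -> (i <= j)%N ->
    (C *m D) i j = if i == j then C i i * D i i else 0.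
  move=> tC tD ij; rewrite mxE; case: eqVneq => [<-|ne].
    rewrite (bigD1 i) //= big1 ?addr0 // => l li.
    case: (ltngtP l i) => [li'|il|/val_inj E]; last by rewrite E eqxx in li.
      by rewrite (tD l i) // mulr0.
    by rewrite (tC i l) // mul0r.
  apply: big1 => l _; case: (ltnP i l) => [il|li]; first by rewrite tC // mul0r.
  by rewrite tD ?mulr0 // (leq_ltn_trans li) // ltn_neqAle ij andbT val_eqE.
move=> ij; rewrite [LHS]mxE [X in _ + X]mxE !E //.
by case: eqP => _; rewrite ?subrr // mulrC subrr.
Qed.

Lemma even_trigonalizable z : G *m z = z *m G ->
  exists R R' : 'M[k]_(n + n), [/\ R *m R' = 1%:M, G *m R = R *m G,
    G *m R' = R' *m G & is_trig_mx (R *m z *m R')].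
Proof.
move/even_blockP ->.
have [P1 [P1' [P1K tP1]]] := trigonalizable (ulsubmx z).
have [P2 [P2' [P2K tP2]]] := trigonalizable (drsubmx z).
exists (block_mx P1 0 0 P2), (block_mx P1' 0 0 P2'); split; try exact: even_block.
  by rewrite mulmx_block !simp P1K P2K -scalar_mx_block.
by rewrite !mulmx_block !simp is_trig_block_mx // eqxx tP1.
Qed.

Section TriangularPart.
Variables (z R R' : 'M[k]_(n + n)).
Let c y := R *m y *m R'.

(** Above the diagonal, the obstruction to [y] being triangular in the new basis; below it, the
    obstruction to commuting with [z]. *)
Definition triangular_part y : 'M[k]_(n + n) := \matrix_(i, j)
  if (i < j)%N then c y i j else
  if (j < i)%N then (c z *m c y - c y *m c z) i j else 0.

Fact triangular_part_is_linear : linear triangular_part.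
Proof.
move=> a u w; have cD : c (a *: u + w) = a *: c u + c w.
  by rewrite /c mulmxDr mulmxDl -scalemxAr -scalemxAl.
apply/matrixP => i j; rewrite [LHS]mxE [RHS]mxE [X in _ = X + _]mxE.
rewrite [X in _ = _ * X + _]mxE [X in _ = _ + X]mxE cD.
rewrite mulmxDr mulmxDl -scalemxAr -scalemxAl.
move: (c u) (c w) (c z *m _) (c z *m _) => cu cw zu zw.
rewrite opprD addrACA -scalerBr; case: ltngtP => _; rewrite ?mulr0 ?addr0 //.
  by rewrite !mxE.
by rewrite [LHS]mxE [X in X + _]mxE.
Qed.
HB.instance Definition _ := GRing.isLinear.Build k 'M[k]_(n + n) 'M[k]_(n + n) *:%R
  triangular_part triangular_part_is_linear.

End TriangularPart.

Definition diag_part z : 'rV[k]_(n + n) := \row_i z i i.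

Fact diag_part_is_linear : linear diag_part.
Proof. by move=> a u w; apply/rowP => i; rewrite !mxE. Qed.
HB.instance Definition _ := GRing.isLinear.Build k 'M[k]_(n + n) 'rV[k]_(n + n) *:%R
  diag_part diag_part_is_linear.

(* After triangularizing z, an even y with vanishing triangular part commutes
   with z: the commutator of triangular matrices is strictly triangular.  The
   triangular part has zero diagonal, so it satisfies 2n conditions less than
   the dimension of the even matrices. *)
Lemma dim_centralizer_ge z : z \in slpart k n false ->
  ((n + n).-1 <= \dim (centralizer z))%N.
Proof.
move=> /(sl_even k0) [ez sz]; have [R [R' [RR' eR eR' tz]]] := even_trigonalizable ez.
have R'R : R' *m R = 1%:M by apply: mulmx1C.
pose E0 := glpart k n n false; pose g0 := slpart k n false.
pose T := linfun (triangular_part z R R'); pose D := linfun diag_part.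
have dg0 : (\dim E0 <= (\dim g0).+1)%N.
  rewrite -(limg_ker_dim (linfun (@str k n n)) E0) capvC -addn1 leq_add2l.
  by rewrite (leq_trans (dimvS (subvf _))) // dimvf.
have dD : (\dim (E0 :&: lker D) + (n + n) = \dim E0)%N.
  rewrite -(limg_ker_dim D E0); congr addn.
  have -> : (D @: E0)%VS = fullv.
    apply/eqP; rewrite eqEsubv subvf /=; apply/subvP => d _.
    apply/memv_imgP; exists (diag_mx d).
      apply/(glpart_even two_neq0)/even_entries => i j; rewrite !mxE.
      by rewrite eq_lrshift eq_rlshift.
    by rewrite lfunE; apply/rowP => i; rewrite !mxE eqxx.
  by rewrite dimvf /dim /= mul1n.
have dT : (\dim (g0 :&: lker T) + \dim (T @: g0) = \dim g0)%N by apply: limg_ker_dim.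
have TS : (\dim (T @: g0) <= \dim (E0 :&: lker D))%N.
  apply/dimvS/subvP => _ /memv_imgP [y /(sl_even k0) [ey _] ->].
  rewrite lfunE /= memv_cap; apply/andP; split; last first.
    by rewrite memv_ker lfunE /=; apply/eqP/rowP => i; rewrite !mxE ltnn.
  apply/(glpart_even two_neq0)/even_entries => i j.
  have lt : (i < n + j)%N by rewrite (leq_trans (ltn_ord i)) // leq_addr.
  have ec u : G *m u = u *m G -> G *m (R *m u *m R') = R *m u *m R' *m G.
    by move=> eu; rewrite !even_mul.
  split; rewrite [LHS]mxE /= lt.
    by case: ((even_entries _).2 (ec _ ey) i j).
  rewrite ltnNge (ltnW lt) /=.
  have : G *m (R *m z *m R' *m (R *m y *m R') - R *m y *m R' *m (R *m z *m R')) =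
         (R *m z *m R' *m (R *m y *m R') - R *m y *m R' *m (R *m z *m R')) *m G.
    by rewrite mulmxBr mulmxBl !(even_mul (ec _ _) (ec _ _)).
  by move/even_entries => /(_ i j) [_].
have : (\dim (g0 :&: lker T) <= \dim (centralizer z))%N.
  apply/dimvS/subvP => y; rewrite memv_cap => /andP[yg yT]; rewrite /centralizer memv_cap yg /=.
  rewrite memv_ker lfunE /= sbr_even //.
  move: yT; rewrite memv_ker lfunE /= => /eqP/matrixP yT.
  pose c u := R *m u *m R'.
  have ty : is_trig_mx (c y).
    by apply/is_trig_mxP => i j ij; move: (yT i j); rewrite !mxE ij.
  have cE : c z *m c y - c y *m c z = R *m (z *m y - y *m z) *m R'.
    have cc u w : c u *m c w = R *m (u *m w) *m R'.
      by rewrite /c !mulmxA -(mulmxA _ R' R) R'R mulmx1.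
    by rewrite !cc mulmxBr mulmxBl.
  have c0 : c z *m c y - c y *m c z = 0.
    apply/matrixP => i j; case: (leqP i j) => [ij|ji].
      by rewrite trig_comm_diag // mxE.
    by move: (yT i j); rewrite [LHS]mxE ltnNge (ltnW ji) /= ji.
  rewrite -[_ - _]mul1mx -R'R -(mulmxA R') -[R *m _]mulmx1 -R'R.
  by rewrite (mulmxA _ R') -cE c0 mul0mx mulmx0.
(* The count: dim centralizer >= dim g0 - dim (E0 with zero diagonal) >= (dim E0 - 1) - (dim E0 -
   2n). *)
by move: dg0 dD dT TS; lia.
Qed.

(** Evaluation at [w] is injective on the even commutant of [z], which thus has dimension at most
    2n. It contains diag(1, 0), of supertrace n, so the centralizer in g0 is strictly smaller and
    meets the lower bound 2n - 1. *)
Lemma regular_of_cyclic z (w : 'cV[k]_(n + n)) : z \in slpart k n false ->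
    (forall y, G *m y = y *m G -> z *m y = y *m z -> y *m w = 0 -> y = 0) ->
  regular z.
Proof.
move=> zg H; split; first exact: zg.
move=> y /dim_centralizer_ge; apply: leq_trans.
have [ez _] := (sl_even k0 z).1 zg.
pose C0 := (glpart k n n false :&: lker (linfun (sbr z)))%VS.
have C0P u : u \in C0 <-> G *m u = u *m G /\ z *m u = u *m z.
  have -> : (u \in C0) = (u \in glpart k n n false) && (z *m u == u *m z).
    by rewrite memv_cap; congr andb; rewrite memv_ker lfunE /= sbr_even // subr_eq0.
  split; first by move=> /andP[/(glpart_even two_neq0) ? /eqP].
  by move=> [/(glpart_even two_neq0) -> ->]; rewrite eqxx.
have dC0 : (\dim C0 <= n + n)%N.
  rewrite -(limg_ker_dim (linfun (mulmxr w)) C0).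
  have -> : (C0 :&: lker (linfun (mulmxr w)))%VS = 0%VS.
    apply/eqP; rewrite -subv0; apply/subvP => u; rewrite memv_cap memv_ker lfunE /=.
    by case/andP => /C0P [eu zu] /eqP /H -> //; rewrite mem0v.
  rewrite dimv0 add0n (leq_trans (dimvS (subvf _))) // dimvf /dim /=.
  by rewrite muln1.
have sub : (centralizer z <= C0)%VS.
  by apply/subvP => u; rewrite !memv_cap => /andP[/andP[_ ->] ->].
suff : (\dim (centralizer z) < \dim C0)%N by move: dC0; lia.
rewrite ltn_neqAle dimvS // andbT; apply/negP => dE.
have /eqP E : centralizer z == C0 by rewrite eqEdim sub (eqP dE) leqnn.
have : block_mx 1%:M 0 0 0 \in C0.
  by apply/C0P; split; rewrite ?even_block // (even_blockP ez) !mulmx_block !simp.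
rewrite -E memv_cap => /andP[/(sl_even k0) [_]].
rewrite /str block_mxKul block_mxKdr mxtrace1 linear0 subr0 => /eqP.
by move/pcharf0P: k0 => ->; rewrite eqn0Ngt n_gt0.
Qed.

End Centralizers.

(** * The principal triple of the shift *)

Section Shift.
Variables (k : fieldType) (d : nat).
Hypothesis k0 : [pchar k] =i pred0.
Implicit Types F : nat -> nat -> k.
Local Notation U := (shift_mx k d).
Local Notation mx F := (\matrix_(i < d, j < d) F (i : nat) (j : nat) : 'M[k]_d).

Lemma mul_mx_shift F : mx F *m U =
  mx (fun i j => if j == 0%N then 0 else F i j.-1).
Proof.
apply/matrixP => i j; rewrite mxE [RHS]mxE; case: eqP => [j0|/eqP j0].
  by apply: big1 => l _; rewrite !mxE j0 mulr0.
have lj : (j.-1 < d)%N by rewrite (leq_ltn_trans (leq_pred _)).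
rewrite (bigD1 (Ordinal lj)) //= big1 ?addr0 => [|l ll].
  by rewrite !mxE /= prednK ?lt0n // eqxx mulr1.
rewrite !mxE; case: eqP => E; last by rewrite mulr0.
by case/eqP: ll; apply/val_inj; rewrite /= -E.
Qed.

Lemma mul_shift_mx F : U *m mx F =
  mx (fun i j => if (i.+1 < d)%N then F i.+1 j else 0).
Proof.
apply/matrixP => i j; rewrite mxE [RHS]mxE; case: ltnP => [ld|dl].
  rewrite (bigD1 (Ordinal ld)) //= big1 ?addr0 => [|l ll].
    by rewrite !mxE /= eqxx mul1r.
  rewrite !mxE; case: eqP => E; last by rewrite mul0r.
  by case/eqP: ll; apply/val_inj; rewrite /= -E.
apply: big1 => l _; rewrite !mxE; case: eqP => E; last by rewrite mul0r.
by have := ltn_ord l; rewrite -E ltnNge dl.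
Qed.

(** The irreducible sl2-module of dimension d, scaled so that the lowering operator is exactly the
    shift; this fixes the raising coefficients (j + 1)(d - j - 1). *)
Definition sl2_h : 'M[k]_d := diag_mx (\row_(a < d) ((2 * a)%:R - (d.-1)%:R)).
Definition sl2_e : 'M[k]_d :=
  \matrix_(i, j) if i == j.+1 :> nat then (j.+1 * (d - j.+1))%:R else 0.

Lemma sl2_h_f : sl2_h *m U - U *m sl2_h = - 2%:R *: U.
Proof.
rewrite mul_diag_mx mul_mx_diag; apply/matrixP => i j; rewrite !mxE.
case: eqP => [<-|_]; last by rewrite !mulr0 mul0r subr0.
by rewrite mulnS natrD; ring.
Qed.

Lemma sl2_h_e : sl2_h *m sl2_e - sl2_e *m sl2_h = 2%:R *: sl2_e.
Proof.
rewrite mul_diag_mx mul_mx_diag; apply/matrixP => i j; rewrite !mxE.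
case: eqP => [->|_]; last by rewrite !mulr0 mul0r subr0.
by rewrite mulnS natrD; ring.
Qed.

Lemma sl2_e_f : sl2_e *m U - U *m sl2_e = sl2_h.
Proof.
pose F i j : k := if i == j.+1 then (j.+1 * (d - j.+1))%:R else 0.
have -> : sl2_e = mx F by apply/matrixP => i j; rewrite !mxE.
rewrite mul_mx_shift mul_shift_mx; apply/matrixP => i j.
rewrite !mxE /F -val_eqE /= eqSS; have ld := ltn_ord i; have jd := ltn_ord j.
case: (eqVneq (i : nat) j) => [ij|ne]; last first.
  case: ifP => j0; first by case: ifP; rewrite subrr.
  rewrite prednK ?lt0n ?j0 // (negPf ne).
  by case: ifP; rewrite subrr.
rewrite -ij in jd *; rewrite mulr1n.
have -> : (if i == 0%N :> nat then 0 else if i == i.-1.+1 :> nat then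
    (i.-1.+1 * (d - i.-1.+1))%:R else 0) = (i * (d - i))%:R :> k.
  by case: (i : nat) => [|l] /=; rewrite ?mul0n // eqxx.
have -> : (if (i.+1 < d)%N then (i.+1 * (d - i.+1))%:R else 0) = (i.+1 * (d - i.+1))%:R :> k.
  by case: ltnP => //; rewrite -subn_eq0 => /eqP ->; rewrite muln0.
apply/eqP; rewrite subr_eq addrAC eq_sym subr_eq -!natrD; apply/eqP.
congr (_%:R); move: ld; move: (i : nat) => l ld {F ij jd i j}.
have -> : (d - l)%N = (d - l.+1).+1 by lia.
have -> : d.-1 = (l + (d - l.+1))%N by lia.
by move: (d - l.+1)%N => c; nia.
Qed.

(** The last basis vector generates the space under the shift, so a commuting matrix is determined
    by its value there. *)
Lemma shift_cyclic : exists v : 'cV[k]_d, forall Z,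
  U *m Z = Z *m U -> Z *m v = 0 -> Z = 0.
Proof.
case: (posnP d) => [d0|d0].
  by exists 0 => Z _ _; apply/matrixP => i; have := ltn_ord i; rewrite {2}d0.
have ld : (d.-1 < d)%N by rewrite prednK.
exists (delta_mx (Ordinal ld) 0) => Z UZ; rewrite -colE => Zl.
have H j (b : 'I_d) : (b + j = d.-1)%N -> col b Z = 0.
  elim: j b => [|j IH] b bE.
    by rewrite -Zl; congr col; apply/val_inj; rewrite /= -bE addn0.
  have lb : (b.+1 < d)%N by lia.
  have Zb : col (Ordinal lb) (Z *m U) = 0.
    by rewrite -UZ colE -mulmxA -colE IH ?mulmx0 //= -bE addnS.
  apply/colP => i; move/colP: Zb => /(_ i); rewrite [LHS]mxE mxE.
  rewrite (bigD1 b) //= big1 ?addr0 => [|l ll].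
    by rewrite !mxE /= eqxx mulr1.
  by rewrite mxE /= eqSS val_eqE (negPf ll) mulr0.
apply/matrixP => i j; have /colP/(_ i) : col j Z = 0.
  by apply: (H (d.-1 - j)%N); have := ltn_ord j; lia.
by rewrite !mxE.
Qed.

(** The first basis vector is cyclic, since in characteristic 0 the coefficients (j + 1)(d - j - 1)
    with j + 1 < d do not vanish. *)
Lemma sl2_e_cyclic : exists v : 'cV[k]_d, forall Z,
  sl2_e *m Z = Z *m sl2_e -> Z *m v = 0 -> Z = 0.
Proof.
case: (posnP d) => [d0|d0].
  by exists 0 => Z _ _; apply/matrixP => i; have := ltn_ord i; rewrite {2}d0.
exists (delta_mx (Ordinal d0) 0) => Z UZ; rewrite -colE => Zl.
have H j (ld : (j < d)%N) : col (Ordinal ld) Z = 0.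
  elim: j ld => [|j IH] ld; first by rewrite -Zl; congr col; apply/val_inj.
  have lb := ltnW ld.
  have Zb : col (Ordinal lb) (Z *m sl2_e) = 0.
    by rewrite -UZ colE -mulmxA -colE IH mulmx0.
  apply/colP => i; move/colP: Zb => /(_ i); rewrite [LHS]mxE mxE.
  rewrite (bigD1 (Ordinal ld)) //= big1 ?addr0 => [|l ll].
    rewrite !mxE /= eqxx => /eqP; rewrite mulf_eq0 orbC; move/pcharf0P: k0 => ->.
    by rewrite muln_eq0 subn_eq0 leqNgt ld /= => /eqP.
  rewrite !mxE; case: eqP => E; last by rewrite mulr0.
  by case/eqP: ll; apply/val_inj.
by apply/matrixP => i [j ld]; have /colP/(_ i) := H j ld; rewrite !mxE.
Qed.

End Shift.

(** (ad N)^j z is a combination of terms N^a z N^b with a + b = j. Assuming vanishing for all a + b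
    >= j avoids binomial coefficients in the induction. *)
Lemma iter_commutator_eq0 (k : fieldType) m (N z : 'M[k]_m) j :
    (forall a b, (j <= a + b)%N -> N ^+ a *m z *m N ^+ b = 0) ->
  iter j (fun y => N *m y - y *m N) z = 0.
Proof.
elim: j z => [|j IH] z H; first by have := H 0%N 0%N isT; rewrite mul1mx mulmx1.
rewrite iterSr; apply: IH => a b jab.
rewrite mulmxBr mulmxBl !mulmxA -exprSr_mx -(mulmxA _ N) -exprS_mx.
by rewrite !H ?subr0 // ?addSn ?addnS.
Qed.

(* The powers Y^j are eigenvectors of ad H for the distinct eigenvalues j c. *)
Lemma nilpotent_of_weight (k : fieldType) m (H Y : 'M[k]_m) c :
    [pchar k] =i pred0 -> c != 0 -> H *m Y - Y *m H = c *: Y ->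
  exists j, Y ^+ j = 0.
Proof.
move=> k0 c0 HY.
have HX j : H *m Y ^+ j - Y ^+ j *m H = (j%:R * c) *: Y ^+ j.
  elim: j => [|j IH]; first by rewrite expr0_mx mul1mx mulmx1 subrr mul0r scale0r.
  rewrite exprS_mx mulmxA -[H *m Y](subrK (Y *m H)) HY mulmxDl.
  rewrite -(mulmxA Y H) -[H *m Y ^+ j](subrK (Y ^+ j *m H)) IH mulmxDr mulmxA.
  by rewrite addrA addrK -scalemxAl -scalemxAr -scalerDl -natr1 mulrDl mul1r addrC.
pose ad := lin_mx (mulmx H) - lin_mx (mulmxr H).
have [/existsP [j /eqP Y0]|/existsPn Yn] := boolP [exists j : 'I_(m * m).+1, Y ^+ j == 0].
  by exists j.
pose s := [seq (j%:R * c : k) | j <- iota 0 (m * m).+1].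
have us : uniq s.
  rewrite map_inj_uniq ?iota_uniq // => i j /(mulIf c0); exact: natr_inj.
have rs : all (root (char_poly ad)) s.
  apply/allP => _ /mapP [j jm ->]; rewrite -eigenvalue_root_char.
  rewrite mem_iota add0n /= in jm.
  apply/eigenvalueP; exists (mxvec (Y ^+ j)).
    by rewrite mulmxBr !mul_vec_lin /= -raddfB /= HX linearZ.
  by have := Yn (Ordinal jm); rewrite mxvec_eq0.
have p0 : char_poly ad != 0 by apply/monic_neq0/char_poly_monic.
by have := max_poly_roots p0 rs us; rewrite size_map size_iota size_char_poly ltnn.
Qed.

(** * Principal triples and weights in adapted bases *)

Section Frame.
Variables (k : closedFieldType) (n : nat).
Hypothesis k0 : [pchar k] =i pred0.
Hypothesis n_gt0 : (0 < n)%N.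

Let two_neq0 : 2%:R != 0 :> k.
Proof. by move/pcharf0P: k0 => ->. Qed.

Let simp := (mulNmx, mulmxN, mul1mx, mulmx1, mul0mx, mulmx0, oppr0, addr0, add0r).

Lemma der_g0_sbr (y z : 'M[k]_(n + n)) : y \in slpart k n false ->
  z \in slpart k n false -> sbr y z \in der_g0 k n.
Proof.
move=> yg zg; have [ey _] := (sl_even k0 y).1 yg; rewrite sbr_even //.
rewrite (coord_vbasis yg) mulmx_suml mulmx_sumr -sumrB; apply: memv_suml => i _.
rewrite -scalemxAl -scalemxAr -scalerBr; apply: memvZ.
rewrite (coord_vbasis zg) mulmx_suml mulmx_sumr -sumrB; apply: memv_suml => j _.
rewrite -scalemxAl -scalemxAr -scalerBr; apply: memvZ.
have ig : (vbasis (slpart k n false))`_i \in slpart k n false.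
  by apply/vbasis_mem/mem_nth; rewrite size_tuple.
have [ei _] := (sl_even k0 _).1 ig.
rewrite -sbr_even //; apply/memv_span/allpairsP.
exists ((vbasis (slpart k n false))`_i, (vbasis (slpart k n false))`_j) => /=.
by split=> //; apply/mem_nth; rewrite size_tuple.
Qed.

Lemma nilpotent_weight (h y : 'M[k]_(n + n)) c : h \in slpart k n false ->
  y \in slpart k n false -> c != 0 -> sbr h y = c *: y -> nilpotent y.
Proof.
move=> hg yg c0 hy; have [eh _] := (sl_even k0 h).1 hg; split.
  by rewrite -[y](scalerK c0) -hy memvZ // der_g0_sbr.
rewrite sbr_even // in hy; have [j yj] := nilpotent_of_weight k0 c0 hy.
(* In y^a z y^b with a + b >= 2j one exponent is at least j. *)
exists (j + j)%N => z zg; have [ey _] := (sl_even k0 y).1 yg.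
rewrite (eq_iter (f' := fun u => y *m u - u *m y)); last first.
  by move=> u; rewrite sbr_even.
apply: iter_commutator_eq0 => a b jab; case: (leqP j a) => [ja|aj].
  by rewrite -(subnK ja) exprD_mx yj mulmx0 !mul0mx.
have jb : (j <= b)%N by lia.
by rewrite -(subnK jb) exprD_mx yj !mulmx0.
Qed.

Variables (Q0 R0 Q1 R1 : 'M[k]_n).
Hypothesis RQ0 : R0 *m Q0 = 1%:M.
Hypothesis RQ1 : R1 *m Q1 = 1%:M.
Local Notation U := (shift_mx k n).

(** The same [A] on both halves of V, each in its own basis; equal traces make the supertrace
    vanish. *)
Definition frame_even (A : 'M[k]_n) : 'M[k]_(n + n) :=
  block_mx (Q0 *m A *m R0) 0 0 (Q1 *m A *m R1).
Definition frame_odd (A B : 'M[k]_n) : 'M[k]_(n + n) :=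
  block_mx 0 (Q0 *m A *m R1) (Q1 *m B *m R0) 0.

Lemma frame_evenB A B : frame_even A - frame_even B = frame_even (A - B).
Proof. by rewrite /frame_even !mulmxBr !mulmxBl opp_block_mx add_block_mx !simp. Qed.

Lemma frame_evenZ c A : c *: frame_even A = frame_even (c *: A).
Proof. by rewrite /frame_even -!scalemxAr -!scalemxAl scale_block_mx !scaler0. Qed.

Lemma frame_even_g0 A : frame_even A \in slpart k n false.
Proof.
apply/(sl_even k0); split; first exact: even_block.
rewrite /str block_mxKul block_mxKdr !(mxtrace_mulC (_ *m A)) !mulmxA RQ0 RQ1.
by rewrite subrr.
Qed.

Lemma frame_odd_g1 A B : frame_odd A B \in slpart k n true.
Proof. by apply/(sl_odd k0); apply: odd_block. Qed.

Lemma frame_oddZ c A B : c *: frame_odd A B = frame_odd (c *: A) (c *: B).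
Proof. by rewrite /frame_odd -!scalemxAr -!scalemxAl scale_block_mx !scaler0. Qed.

Lemma frame_sbr A B : sbr (frame_even A) (frame_even B) = frame_even (A *m B - B *m A).
Proof.
rewrite sbr_even //; last exact: even_block.
rewrite -frame_evenB /frame_even !mulmx_block !simp !mulmxA.
by rewrite -!(mulmxA _ R0 Q0) -!(mulmxA _ R1 Q1) RQ0 RQ1 !mulmx1.
Qed.

Lemma frame_sbr_odd A B C : sbr (frame_even A) (frame_odd B C) =
  frame_odd (A *m B - B *m A) (A *m C - C *m A).
Proof.
rewrite sbr_even //; last exact: even_block.
rewrite /frame_even /frame_odd !mulmx_block !simp !mulmxA.
rewrite -!(mulmxA _ R0 Q0) -!(mulmxA _ R1 Q1) RQ0 RQ1 !mulmx1.
by rewrite opp_block_mx add_block_mx !simp !mulmxBr !mulmxBl !mulmxA.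
Qed.

Lemma frame_regular A : (exists v : 'cV[k]_n, forall Z,
    A *m Z = Z *m A -> Z *m v = 0 -> Z = 0) -> regular (frame_even A).
Proof.
move=> [v Hv]; have QR0 := mulmx1C RQ0; have QR1 := mulmx1C RQ1.
apply: (regular_of_cyclic k0 n_gt0 (w := col_mx (Q0 *m v) (Q1 *m v)) (frame_even_g0 A)).
move=> y /(even_blockP k0) ->; rewrite !mulmx_block !simp.
move=> /eq_block_mx [E0 _ _ E1]; rewrite mul_block_col !simp -[0]vsubmxK => /eq_col_mx [v0 v1].
rewrite !linear0 in v0 v1.
have key Q R y0 : R *m Q = 1%:M -> Q *m R = 1%:M -> Q *m A *m R *m y0 = y0 *m (Q *m A *m R) ->
    y0 *m (Q *m v) = 0 -> y0 = 0.
  move=> RQ QR E yv; have : R *m y0 *m Q = 0.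
    apply: Hv; last by rewrite -!mulmxA yv mulmx0.
    have : R *m (Q *m A *m R *m y0) *m Q = R *m (y0 *m (Q *m A *m R)) *m Q by rewrite E.
    by rewrite !mulmxA RQ mul1mx -(mulmxA _ R Q) RQ mulmx1.
  move=> Z0; rewrite -[y0]mulmx1 -[y0]mul1mx -QR !mulmxA -(mulmxA Q) -(mulmxA Q).
  by rewrite Z0 mulmx0 mul0mx.
by rewrite (key _ _ _ _ RQ0 QR0 E0 v0) (key _ _ _ _ RQ1 QR1 E1 v1) block_mx0.
Qed.

Lemma frame_principal_triple : principal_sl2_triple (frame_even (sl2_e k n))
  (frame_even (sl2_h k n)) (frame_even U).
Proof.
have he : sbr (frame_even (sl2_h k n)) (frame_even (sl2_e k n)) =
    2%:R *: frame_even (sl2_e k n) by rewrite frame_sbr sl2_h_e frame_evenZ.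
have hf : sbr (frame_even (sl2_h k n)) (frame_even U) =
    - 2%:R *: frame_even U by rewrite frame_sbr sl2_h_f frame_evenZ.
split.
- by split=> //; [split; apply: frame_even_g0|rewrite frame_sbr sl2_e_f].
- split; last exact/frame_regular/sl2_e_cyclic.
  exact: nilpotent_weight (frame_even_g0 _) (frame_even_g0 _) two_neq0 he.
- split; last exact/frame_regular/shift_cyclic.
  apply: nilpotent_weight (frame_even_g0 _) (frame_even_g0 _) _ hf.
  by rewrite oppr_eq0.
Qed.

Lemma frame_weights a0 a1 b0 b1 :
  let x := frame_odd (a0%:M + a1 *: U) (b0%:M + b1 *: U) in
  exists x0 x2 : 'M[k]_(n + n),
    [/\ x0 \in slpart k n true, x2 \in slpart k n true, x = x0 + x2,
        sbr (frame_even (sl2_h k n)) x0 = 0 &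
        sbr (frame_even (sl2_h k n)) x2 = - 2%:R *: x2].
Proof.
exists (frame_odd a0%:M b0%:M), (frame_odd (a1 *: U) (b1 *: U)).
split; try exact: frame_odd_g1.
- by rewrite /frame_odd add_block_mx !simp !mulmxDr !mulmxDl.
- rewrite frame_sbr_odd !(scalar_mxC _ (sl2_h k n)) !subrr.
  by rewrite /frame_odd !simp block_mx0.
- rewrite frame_sbr_odd -!scalemxAr -!scalemxAl -!scalerBr sl2_h_f.
  by rewrite frame_oddZ !scalerA [_ * a1]mulrC [_ * b1]mulrC.
Qed.

End Frame.

Section Balanced.
Variables (k : closedFieldType) (n : nat).
Hypothesis k0 : [pchar k] =i pred0.

Lemma strongly_balanced_of_weights (x f e h x0 x2 : 'M[k]_(n + n)) a :
    jordan_dec (half_square x) a%:M f -> sl2_triple e h f ->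
    x0 \in slpart k n true -> x2 \in slpart k n true -> x = x0 + x2 ->
    sbr h x0 = 0 -> sbr h x2 = - 2%:R *: x2 ->
  strongly_balanced x.
Proof.
move=> jd tr x0g x2g xE hx0 hx2; exists a%:M, f; split=> //.
have [->|/eqP f0] := eqVneq f 0; [by left|right; split=> //].
exists e, h; split=> //.
  rewrite sbr_even; last by rewrite scalar_mxC.
    by rewrite scalar_mxC subrr.
  by move/pcharf0P: k0 => ->.
(* Indices are opposite weights, so place 1, which strong balance requires to vanish, lies between
   [x0] and [x2]. *)
exists 3%N, (fun i => if i == 0%N then x0 else if i == 2%N then x2 else 0); split=> //.
  by rewrite !big_ord_recl big_ord0 /= add0r addr0.
case=> [|[|[|i]]] /=; rewrite ?mem0v ?linear0 ?scaler0 ?hx0 ?oppr0 ?scale0r //.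
Qed.

End Balanced.

(** * Distinguished elements with an invertible block *)

Section SingleChain.
Variables (k : closedFieldType) (n : nat).
Hypothesis k0 : [pchar k] =i pred0.
Hypothesis n_gt0 : (0 < n)%N.

Let two_neq0 : 2%:R != 0 :> k.
Proof. by move/pcharf0P: k0 => ->. Qed.

Let simp := (mulNmx, mulmxN, mul1mx, mulmx1, mul0mx, mulmx0, oppr0, addr0, add0r).

Lemma chain_proj_neq0 m (N : 'M[k]_m) d v phi : is_chain N d v phi ->
  chain_cols N d v *m chain_rows N d phi != 0.
Proof.
move=> ch; apply/eqP => E; have := chain_proj_trace ch.
rewrite E raddf0 => /esym/eqP; move/pcharf0P: k0 => ->.
by case: ch; case: d {E}.
Qed.

Lemma full_chain_length m (N : 'M[k]_m) d v phi : is_chain N d v phi ->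
  chain_cols N d v *m chain_rows N d phi = 1%:M -> d = m.
Proof.
move=> ch E; have := chain_proj_trace ch.
by rewrite E mxtrace1 => /esym/(natr_inj k0).
Qed.

(** A chain projection is a nonzero idempotent commuting with [N], hence 1: a single chain fills the
    space. *)
Lemma nilpotent_without_idem (N : 'M[k]_n) m : N ^+ m = 0 ->
    (forall p, p *m p = p -> p *m N = N *m p -> p = 0 \/ p = 1%:M) ->
  exists Q R : 'M[k]_n, R *m Q = 1%:M /\ N = Q *m shift_mx k n *m R.
Proof.
move=> Nm H; have [d [v [phi [ch _ _]]]] : exists d v phi,
    [/\ is_chain N d v phi, 1%:M *m v = v & phi *m 1%:M = phi].
  apply: (@ex_chain k n N 1%:M m); rewrite ?mulmx1 ?mul1mx //.
  apply/eqP => /matrixP/(_ (Ordinal n_gt0) (Ordinal n_gt0)); rewrite !mxE eqxx => /eqP.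
  by rewrite oner_eq0.
have [p0|p1] := H _ (chain_proj_idem ch) (chain_proj_comm ch).
  by have := chain_proj_neq0 ch; rewrite p0 eqxx.
have dn := full_chain_length ch p1; subst d.
exists (chain_cols N n v), (chain_rows N n phi); split.
  exact: chain_rows_cols.
by rewrite -(mul_chain_cols ch) -mulmxA p1 mulmx1.
Qed.

Lemma expr_block_diag (A B : 'M[k]_n) m :
  (block_mx A 0 0 B) ^+ m = block_mx (A ^+ m) 0 0 (B ^+ m).
Proof.
elim: m => [|m IH]; first by rewrite !expr0_mx -scalar_mx_block.
by rewrite !exprS_mx IH mulmx_block !simp.
Qed.

Lemma odd_blockP (x : 'M[k]_(n + n)) : G *m x = - (x *m G) ->
  x = block_mx 0 (ursubmx x) (dlsubmx x) 0.
Proof. by move=> ox; rewrite -{1}(mxhom_odd two_neq0 true ox). Qed.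

(* A chain decomposition of the even part transports through the invertible
   block, so it is indecomposable when x is distinguished. *)
Lemma distinguished_frame (x : 'M[k]_(n + n)) a m : x \in slpart k n true ->
    distinguished x -> (x *m x - a%:M) ^+ m = 0 ->
    ursubmx x \in unitmx \/ dlsubmx x \in unitmx ->
  exists (Q0 R0 Q1 R1 : 'M[k]_n) (a0 a1 b0 b1 : k),
    [/\ R0 *m Q0 = 1%:M, R1 *m Q1 = 1%:M,
        x = frame_odd Q0 R0 Q1 R1 (a0%:M + a1 *: shift_mx k n) (b0%:M + b1 *: shift_mx k n) &
        x *m x - a%:M = frame_even Q0 R0 Q1 R1 (shift_mx k n)].
Proof.
move=> /(sl_odd k0) ox dx; have /odd_blockP xE := ox.
move: (ursubmx x) (dlsubmx x) xE => A B xE; rewrite {}xE in ox dx *.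
rewrite !mulmx_block !simp.
have -> : block_mx (A *m B) 0 0 (B *m A) - a%:M = block_mx (A *m B - a%:M) 0 0 (B *m A - a%:M).
  by rewrite scalar_mx_block opp_block_mx add_block_mx !simp.
rewrite expr_block_diag => /eqP; rewrite block_mx_eq0 => /and4P[/eqP N0 _ _ /eqP N1].
have comm p (N : 'M[k]_n) : p *m (N - a%:M) = (N - a%:M) *m p -> p *m N = N *m p.
  by rewrite mulmxBr mulmxBl scalar_mxC => /addIr.
(* diag(p, q) commutes with x, and equal traces give it supertrace 0, so distinguishedness
   applies. *)
have idem p q : p *m p = p -> q *m q = q -> \tr p = \tr q -> p *m A = A *m q ->
    q *m B = B *m p -> (p = 0 /\ q = 0) \/ (p = 1%:M /\ q = 1%:M).
  move=> pp qq tpq pA qB.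
  have := idem_distinguished k0 n_gt0 dx (even_block p q).
  rewrite !mulmx_block !simp pp qq pA qB /str block_mxKul block_mxKdr tpq subrr.
  case=> // [/eqP|/eqP]; last rewrite scalar_mx_block.
    by rewrite block_mx_eq0 => /and4P[/eqP -> _ _ /eqP ->]; left.
  by move/eqP/eq_block_mx => [-> _ _ ->]; right.
case=> [uA|uB].
- have [|Q [R [RQ NE]]] := nilpotent_without_idem N1.
    move=> q qq /comm qN; case: (idem (A *m q *m invmx A) q) => //.
    + by rewrite !mulmxA mulmxKV // -(mulmxA A q) qq.
    + by rewrite mxtrace_mulC mulmxA mulVmx // mul1mx.
    + by rewrite mulmxKV.
    + by rewrite !mulmxA -qN !mulmxA mulmxK.
    + by case; left.
    + by case; right.
  have QR := mulmx1C RQ.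
  have NB : B *m A = a%:M + Q *m shift_mx k n *m R by rewrite -NE addrC subrK.
  (* The even basis is the image under [A] of the odd one: [A] becomes the identity, and [B] becomes
     a + U because B A does. *)
  exists (A *m Q), (R *m invmx A), Q, R, 1, 0, a, 1; split=> //.
  + by rewrite !mulmxA mulmxKV.
  + congr block_mx; first by rewrite scale0r addr0 mulmx1 -mulmxA QR mulmx1.
    rewrite scale1r mulmxA mulmxDr mulmxDl mul_mx_scalar -scalemxAl QR scalemx1.
    by rewrite -NB mulmxK.
  + congr block_mx; rewrite // -!mulmxA (mulmxA Q) (mulmxA (Q *m _)) -NE mulmxBl mulmxBr.
    by rewrite mulmxK // mul_scalar_mx -scalemxAr mulmxV // scalemx1.
have [|Q [R [RQ NE]]] := nilpotent_without_idem N0.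
  move=> p pp /comm pN; case: (idem p (B *m p *m invmx B)) => //.
  + by rewrite !mulmxA mulmxKV // -(mulmxA B p) pp.
  + by rewrite [RHS]mxtrace_mulC mulmxA mulVmx // mul1mx.
  + by rewrite !mulmxA -pN !mulmxA mulmxK.
  + by rewrite mulmxKV.
  + by case; left.
  + by case; right.
have QR := mulmx1C RQ.
have NA : A *m B = a%:M + Q *m shift_mx k n *m R by rewrite -NE addrC subrK.
exists Q, R, (B *m Q), (R *m invmx B), a, 1, 1, 0; split=> //.
+ by rewrite !mulmxA mulmxKV.
+ congr block_mx; last by rewrite scale0r addr0 mulmx1 -mulmxA QR mulmx1.
  rewrite scale1r mulmxA mulmxDr mulmxDl mul_mx_scalar -scalemxAl QR scalemx1.
  by rewrite -NA mulmxK.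
+ congr block_mx; rewrite // -!mulmxA (mulmxA Q) (mulmxA (Q *m _)) -NE mulmxBl mulmxBr.
  by rewrite mulmxK // mul_scalar_mx -scalemxAr mulmxV // scalemx1.
Qed.

End SingleChain.

(** * Homogeneous chains *)

Section GradedChains.
Variables (k : fieldType) (p q : nat).
Hypothesis two_neq0 : 2%:R != 0 :> k.
Implicit Types x e : 'M[k]_(p + q).

Lemma odd_expr x j : G *m x = - (x *m G) -> G *m x ^+ j = (-1) ^+ j *: (x ^+ j *m G).
Proof.
move=> ox; elim: j => [|j IH]; first by rewrite !expr0_mx mulmx1 mul1mx scale1r.
rewrite exprS_mx mulmxA ox mulNmx -(mulmxA x G) IH -scalemxAr (mulmxA x).
by rewrite exprS mulN1r scaleNr.
Qed.

Lemma ex_graded_chain x e j : G *m x = - (x *m G) -> G *m e = e *m G ->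
    e *m x = x *m e -> e *m e = e -> e != 0 -> x ^+ j *m e = 0 ->
  exists d v phi eps, [/\ is_chain x d v phi, e *m v = v, phi *m e = phi,
    eps * eps = 1 & G *m v = (eps * (-1) ^+ d.-1) *: v /\ phi *m G = eps *: phi].
Proof.
move=> ox Ge ex ee e0 xj; have [d [x0 xd]] := ex_nilpotency_degree e0 xj.
have [w wn] := mulmx_col_neq0 xd.
(* The homogeneous vectors e w + G e w and e w - G e w add up to 2 e w, so x^d cannot kill both. *)
have [eta [eta2 vn]] : exists eta : k, eta * eta = 1 /\
    x ^+ d *m (e *m w + eta *: (G *m (e *m w))) != 0.
  have [E1|] := eqVneq (x ^+ d *m (e *m w + 1 *: (G *m (e *m w)))) 0; last first.
    by exists 1; rewrite mulr1.
  have [E2|] := eqVneq (x ^+ d *m (e *m w + (-1) *: (G *m (e *m w)))) 0; last first.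
    by exists (-1); rewrite mulrNN mulr1.
  case/eqP: wn; rewrite -mulmxA; apply/eqP.
  rewrite -(inj_eq (scalerI two_neq0)) scaler0 scaler_nat mulr2n -mulmxDr.
  have /eqP := congr2 +%R E1 E2; rewrite addr0 -mulmxDr scale1r scaleN1r.
  by rewrite addrACA subrr addr0.
set v := e *m w + _ in vn.
have Gv : G *m v = eta *: v.
  rewrite /v mulmxDr -scalemxAr (mulmxA G G) parity_mxK mul1mx scalerDr scalerA eta2.
  by rewrite scale1r addrC.
have ev : e *m v = v.
  rewrite /v mulmxDr (mulmxA e e) ee -scalemxAr (mulmxA e G) -Ge -(mulmxA G e).
  by rewrite (mulmxA e e) ee.
have Gxv i : G *m (x ^+ i *m v) = ((-1) ^+ i * eta) *: (x ^+ i *m v).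
  by rewrite mulmxA odd_expr // -scalemxAl -mulmxA Gv -scalemxAr scalerA.
have [phi0 [ch phie]] := dual_covector ex ee x0 ev vn.
have [_ xv phix H] := ch.
(* The parity sign of x^d v, the only vector of the chain on which [phi0] is nonzero; projecting
   [phi0] to the [eps]-part of the dual therefore keeps all pairings. *)
pose eps := eta * (-1) ^+ d; have sgn2 i : (-1) ^+ i * (-1) ^+ i = 1 :> k.
  by rewrite -exprMn mulrNN mulr1 expr1n.
have eps2 : eps * eps = 1 by rewrite mulrACA eta2 sgn2 mulr1.
pose phi := 2%:R^-1 *: (phi0 + eps *: (phi0 *m G)).
have phie' : phi *m e = phi.
  by rewrite -scalemxAl mulmxDl phie -scalemxAl -mulmxA Ge mulmxA phie.
exists d.+1, v, phi, eps; split=> //; last first.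
  split; first by rewrite /= -mulrA sgn2 mulr1.
  rewrite /phi -scalemxAl mulmxDl -scalemxAl -(mulmxA phi0) parity_mxK mulmx1.
  rewrite [RHS]scalerA [eps * _]mulrC -[RHS]scalerA [eps *: (_ + _)]scalerDr scalerA eps2.
  by rewrite scale1r addrC.
split=> //.
  rewrite -scalemxAl mulmxDl phix add0r -scalemxAl -mulmxA odd_expr // -scalemxAr.
  by rewrite mulmxA phix mul0mx !scaler0.
move=> i; rewrite -mulmxA -scalemxAl mulmxDl mulmxA H -scalemxAl -(mulmxA phi0) Gxv.
rewrite -scalemxAr (mulmxA phi0) H; case: eqP => [[->]|_]; last first.
  by rewrite raddf0 !scaler0 addr0 scaler0.
rewrite scalerA /eps -mulrA (mulrA (_ ^+ d)) sgn2 mul1r eta2 scale1r -mulr2n.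
by rewrite -scaler_nat scalerA mulVf // scale1r.
Qed.

Lemma trace_sign_mx d : \tr (sign_mx k d) = (odd d)%:R.
Proof.
rewrite mxtrace_diag; transitivity (\sum_(a < d) (-1) ^+ a : k).
  by apply: eq_bigr => a _; rewrite mxE.
elim: d => [|d IH]; first by rewrite big_ord0.
rewrite big_ord_recr /= IH -signr_odd; case: (odd d) => /=; last by rewrite add0r expr0.
by rewrite expr1 subrr.
Qed.

Lemma vhomE b (v : 'cV[k]_(p + q)) : vhom b v = 2%:R^-1 *: (v + (-1) ^+ b *: (G *m v)).
Proof.
apply: (scalerI two_neq0); rewrite scalerA divff // scale1r -{2 3}[v]vsubmxK.
rewrite mul_block_col !(mulNmx, mul1mx, mul0mx, addr0, add0r).
case: b; rewrite /vhom /= ?expr1 ?expr0 ?scaleN1r ?scale1r ?opp_col_mx add_col_mx ?opprK ?subrr.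
  by rewrite scale_col_mx scaler0 scaler_nat mulr2n.
by rewrite scale_col_mx scaler0 scaler_nat mulr2n.
Qed.

Section OneGradedChain.
Variables (x : 'M[k]_(p + q)) (d : nat) (v : 'cV[k]_(p + q)) (phi : 'rV[k]_(p + q)).
Variable eps : k.
Hypothesis ch : is_chain x d v phi.
Hypothesis ox : G *m x = - (x *m G).
Hypothesis Gv : G *m v = (eps * (-1) ^+ d.-1) *: v.
Hypothesis phiG : phi *m G = eps *: phi.
Let Q := chain_cols x d v.
Let R := chain_rows x d phi.

Lemma graded_chain_proj_even : G *m (Q *m R) = Q *m R *m G.
Proof.
rewrite mulmxA (mul_chain_cols_sign ch ox Gv) -mulmxA (chain_rows_sign d ox phiG).
by rewrite -scalemxAl -scalemxAr mulmxA.
Qed.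

(** Parities alternate along a chain, so the supertrace is an alternating sum of signs; this is the
    source of the odd dimensions. *)
Lemma str_graded_chain_proj : str (Q *m R) = eps * (odd d)%:R.
Proof.
rewrite str_parity mulmxA (mul_chain_cols_sign ch ox Gv) -scalemxAl mxtraceZ.
by rewrite mxtrace_mulC mulmxA (chain_rows_cols ch) mul1mx trace_sign_mx.
Qed.

End OneGradedChain.

(** In chain coordinates x is the shift, whose kernel is spanned by the first basis vector, and
    column 0 of the chain is x^(d-1) v. *)
Lemma chain_ker x d v phi (u : 'cV[k]_(p + q)) : is_chain x d v phi ->
    chain_cols x d v *m chain_rows x d phi *m u = u -> x *m u = 0 ->
  exists c, u = c *: (x ^+ d.-1 *m v).
Proof.
move=> ch pu xu; have [d0 _ _ _] := ch.
exists ((chain_rows x d phi *m u) (Ordinal d0) 0).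
set c := chain_rows x d phi *m u.
have Uc : shift_mx k d *m c = 0.
  by rewrite mulmxA -(chain_rows_mul ch) -mulmxA xu mulmx0.
have cE : c = c (Ordinal d0) 0 *: delta_mx (Ordinal d0) 0.
  move: (c) Uc => c' Uc; apply/colP => -[[|a] ad].
    by rewrite !mxE eqxx andbT -val_eqE /= mulr1; congr (c' _ _); apply/val_inj.
  have ad' := ltnW ad; move/colP: Uc => /(_ (Ordinal ad')).
  rewrite mxE (bigD1 (Ordinal ad)) //= mxE /= eqxx mul1r big1 ?addr0; last first.
    move=> b ba; rewrite mxE /=; case: eqP => E; last by rewrite mul0r.
    by case/eqP: ba; apply/val_inj.
  by move=> ->; rewrite !mxE -val_eqE /= mulr0.
by rewrite -{1}pu -mulmxA -/c {1}cE -scalemxAr -colE col_chain_cols subn1.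
Qed.

End GradedChains.

(** * Chains as indecomposable graded modules *)

Section ChainModules.
Variables (k : fieldType) (n : nat).
Hypothesis two_neq0 : 2%:R != 0 :> k.
Implicit Types x : 'M[k]_(n + n).

Definition chain_space x d v : {vspace 'cV[k]_(n + n)} :=
  limg (linfun (mulmx (chain_cols x d v) : 'cV_d -> 'cV_(n + n))).

Lemma mem_chain_space x d v phi (u : 'cV[k]_(n + n)) : is_chain x d v phi ->
  u \in chain_space x d v <-> chain_cols x d v *m chain_rows x d phi *m u = u.
Proof.
move=> ch; split=> [/memv_imgP [c _ ->]|<-].
  by rewrite lfunE /= -mulmxA (mulmxA (chain_rows _ _ _)) (chain_rows_cols ch) mul1mx.
rewrite -mulmxA; apply/memv_imgP; exists (chain_rows x d phi *m u); first exact: memvf.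
by rewrite lfunE.
Qed.

Lemma dim_chain_space x d v phi : is_chain x d v phi -> \dim (chain_space x d v) = d.
Proof.
move=> ch; have := limg_ker_dim (linfun (mulmx (chain_cols x d v) : 'cV_d -> 'cV_(n + n))) fullv.
have -> : (fullv :&: lker (linfun (mulmx (chain_cols x d v) : 'cV_d -> 'cV_(n + n))) = 0)%VS.
  apply/eqP; rewrite -subv0; apply/subvP => c; rewrite memv_cap memvf memv_ker lfunE /=.
  move=> /eqP Qc; rewrite memv0 -[c]mul1mx -(chain_rows_cols ch) -mulmxA Qc mulmx0.
  by [].
by rewrite dimv0 add0n dimvf /dim /= muln1.
Qed.

(** The kernel of x on a chain is a line, and every nonzero submodule contains it; two of them
    cannot meet in 0. *)
Lemma chain_space_indecomposable x d v phi : is_chain x d v phi ->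
    let p := chain_cols x d v *m chain_rows x d phi in
    G *m p = p *m G -> indecomposable x (chain_space x d v).
Proof.
move=> ch p Gp; have d0 : (0 < d)%N by case: ch.
have xp : p *m x = x *m p := chain_proj_comm ch.
have memU u := mem_chain_space u ch.
split.
- split=> [b u|u] /memU pu; apply/memU; last by rewrite mulmxA xp -mulmxA pu.
  by rewrite vhomE // -scalemxAr mulmxDr pu -scalemxAr mulmxA -Gp -mulmxA pu.
- by move=> U0; have := dim_chain_space ch; rewrite U0 dimv0 => E; rewrite -E in d0.
move=> U1 U2 [_ s1] [_ s2] [U12 U0].
have socle (W : {vspace 'cV[k]_(n + n)}) : (W <= chain_space x d v)%VS ->
    (forall u, u \in W -> x *m u \in W) -> W != 0%VS -> x ^+ d.-1 *m v \in W.
  move=> sW xW; rewrite -subv0 => /subvPn [u uW u0]; rewrite memv0 in u0.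
  have [l [ul0 ul]] : exists l, x ^+ l.+1 *m u = 0 /\ x ^+ l *m u != 0.
    have : x ^+ d *m u = 0.
      move/subvP/(_ _ uW)/memU: sW => <-.
      by rewrite !mulmxA (expr_chain_cols ch) !mul0mx.
    exact: ex_nilpotency_degree.
  have xlW : x ^+ l *m u \in W.
    elim: l {ul0 ul} => [|l IH]; first by rewrite expr0_mx mul1mx.
    by rewrite exprS_mx -mulmxA; apply: xW.
  have [c E] : exists c, x ^+ l *m u = c *: (x ^+ d.-1 *m v).
    apply: (chain_ker ch); first exact/memU/(subvP sW).
    by rewrite mulmxA -exprS_mx.
  have c0 : c != 0 by apply: contraNneq ul => c0; rewrite E c0 scale0r.
  by rewrite -[_ *m v](scalerK c0) -E memvZ.
have [->|n1] := eqVneq U1 0%VS; first by left.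
have [->|n2] := eqVneq U2 0%VS; first by right.
have := U0; have : x ^+ d.-1 *m v \in (U1 :&: U2)%VS.
  by rewrite memv_cap !socle // -U12 ?addvSl ?addvSr.
move=> /[swap] ->; rewrite memv0 => /eqP v0.
case: ch => _ _ _ /(_ d.-1); rewrite prednK // eqxx -mulmxA v0 mulmx0 => /matrixP/(_ 0 0).
by rewrite !mxE => /eqP; rewrite eq_sym oner_eq0.
Qed.

End ChainModules.

(** * Odd Jordan blocks for osp(1|2) *)

Section OddBlocks.
Variables (k : fieldType) (m : nat) (X Y H : 'M[k]_m).
Hypothesis k0 : [pchar k] =i pred0.
Hypothesis XY : X *m Y + Y *m X = H.
Hypothesis HX : H *m X - X *m H = - X.
Hypothesis HY : H *m Y - Y *m H = Y.

Let XYE : X *m Y = H - Y *m X.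
Proof. by rewrite -XY addrK. Qed.

Let HXE : H *m X = X *m H - X.
Proof. by rewrite -HX addrC subrK. Qed.

Let HYE : H *m Y = Y *m H + Y.
Proof. by rewrite -{3}HY addrC subrK. Qed.

(** Moving X past Y twice, the terms in H combine to [X, Y^2] = Y, and each further Y^2 adds one
    such term. Odd powers retain H and need a separate formula. *)
Lemma osp_X_Yeven b :
  X *m Y ^+ b.*2.+2 = Y ^+ b.*2.+2 *m X + b.+1%:R *: Y ^+ b.*2.+1.
Proof.
have XYY : X *m Y *m Y = Y *m Y *m X + Y.
  rewrite XYE mulmxBl HYE -(mulmxA Y X) XYE mulmxBr mulmxA opprB.
  by rewrite [Y *m H + Y]addrC -addrA [Y *m H + _]addrC subrK addrC.
elim: b => [|b IH].
  by rewrite !exprS_mx expr0_mx !mulmx1 mulmxA XYY scale1r.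
rewrite doubleS [Y ^+ b.*2.+4]exprSr_mx [Y ^+ b.*2.+3]exprSr_mx.
have BY : Y ^+ b.*2.+1 *m Y = Y ^+ b.*2.+2 by rewrite -exprSr_mx.
move: (Y ^+ b.*2.+2) (Y ^+ b.*2.+1) BY IH => A B BY IH.
rewrite !mulmxA IH 2!mulmxDl -2!scalemxAl BY -(mulmxA A X Y) -(mulmxA A _ Y) XYY.
rewrite mulmxDr !mulmxA -addrA; congr (_ + _).
by rewrite -[X in X + _]scale1r -scalerDl nat1r.
Qed.

Lemma osp_X_Yodd b :
  X *m Y ^+ b.*2.+1 = Y ^+ b.*2 *m (H + b%:R%:M) - Y ^+ b.*2.+1 *m X.
Proof.
case: b => [|b]; first by rewrite !expr1 expr0_mx mul1mx raddf0 addr0 XYE.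
rewrite doubleS [Y ^+ b.*2.+3]exprSr_mx mulmxA osp_X_Yeven mulmxDl -mulmxA XYE.
rewrite mulmxBr mulmxA -scalemxAl -exprSr_mx mulmxDr mul_mx_scalar.
by rewrite addrAC.
Qed.

Lemma osp_Xeven_Y c :
  X ^+ c.*2.+2 *m Y = Y *m X ^+ c.*2.+2 + c.+1%:R *: X ^+ c.*2.+1.
Proof.
have XXY : X *m (X *m Y) = Y *m (X *m X) + X.
  rewrite {1}XYE mulmxBr (mulmxA X Y) XYE mulmxBl HXE !opprB -(mulmxA Y X).
  by rewrite addrC addrA subrK.
elim: c => [|c IH].
  by rewrite !exprS_mx expr0_mx !mulmx1 -mulmxA XXY scale1r.
rewrite doubleS [X ^+ c.*2.+4]exprS_mx [X ^+ c.*2.+3]exprS_mx.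
have XB : X *m X ^+ c.*2.+1 = X ^+ c.*2.+2 by rewrite -exprS_mx.
move: (X ^+ c.*2.+2) (X ^+ c.*2.+1) XB IH => A B XB IH.
rewrite -!mulmxA IH 2!mulmxDr -2!scalemxAr XB (mulmxA X Y A) (mulmxA X _ A) XXY.
rewrite mulmxDl -!mulmxA -addrA; congr (_ + _).
by rewrite -[X in X + _]scale1r -scalerDl nat1r.
Qed.

Lemma osp_Xodd_Y c :
  X ^+ c.*2.+1 *m Y = (H + c%:R%:M) *m X ^+ c.*2 - Y *m X ^+ c.*2.+1.
Proof.
case: c => [|c]; first by rewrite !expr1 expr0_mx mulmx1 raddf0 addr0 XYE.
rewrite doubleS [X ^+ c.*2.+3]exprS_mx -mulmxA osp_Xeven_Y mulmxDr mulmxA XYE.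
rewrite mulmxBl -mulmxA -scalemxAr -!exprS_mx mulmxDl mul_scalar_mx.
by rewrite addrAC.
Qed.

Lemma X_weight (w : 'cV[k]_m) c : X *m w = 0 -> X *m ((H + c%:M) *m w) = 0.
Proof.
move=> Xw; rewrite mulmxA mulmxDr -[X *m H](subrK X) -HXE scalar_mxC !mulmxDl -!mulmxA.
by rewrite Xw !mulmx0 !addr0.
Qed.

Lemma weight_factorC c e : (H + c%:M) *m (H + e%:M) = (H + e%:M) *m (H + c%:M).
Proof.
rewrite !mulmxDr !mulmxDl -!scalar_mxM (mulrC c) !(scalar_mxC _ H).
by rewrite -!addrA; congr (_ + _); rewrite addrCA.
Qed.

(** The product of H + b over j <= b < j + K; that it kills a vector expresses that only weights -b
    occur there. *)
Fixpoint weight_prod j K : 'M[k]_m :=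
  if K is K'.+1 then weight_prod j.+1 K' *m (H + j%:R%:M) else 1%:M.

Lemma weight_prod_comm j K c :
  (H + c%:M) *m weight_prod j K = weight_prod j K *m (H + c%:M).
Proof.
elim: K j => [|K IH] j /=; first by rewrite mulmx1 mul1mx.
by rewrite mulmxA IH -!mulmxA weight_factorC.
Qed.

Lemma weight_prodSr j K :
  weight_prod j K.+1 = weight_prod j K *m (H + (j + K)%:R%:M).
Proof.
elim: K j => [|K IH] j; first by rewrite /= addn0.
rewrite -[LHS]/(weight_prod j.+1 K.+1 *m (H + j%:R%:M)) IH -!mulmxA addSnnS.
by rewrite weight_factorC.
Qed.

(** X X Y^(2i+2) w = (i + 1) Y^(2i) (H + i) w, and (H + i) w is again killed by X, so induction
    collects one weight factor per double step. *)
Lemma weight_prod_lowest i (w : 'cV[k]_m) : X *m w = 0 ->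
  exists2 c, c != 0 & X ^+ i.*2 *m (Y ^+ i.*2 *m w) = c *: (weight_prod 0 i *m w).
Proof.
elim: i w => [|i IH] w Xw.
  by exists 1; rewrite ?oner_eq0 // !expr0_mx !mul1mx scale1r.
have [c c0 E] := IH _ (X_weight i%:R Xw).
exists (i.+1%:R * c).
  by rewrite mulf_neq0 //; move/pcharf0P: k0 => ->.
have E2 : X *m (X *m (Y ^+ i.*2.+2 *m w)) = i.+1%:R *: (Y ^+ i.*2 *m ((H + i%:R%:M) *m w)).
  rewrite (mulmxA X (Y ^+ _)) osp_X_Yeven mulmxDl -mulmxA Xw mulmx0 add0r -scalemxAl.
  rewrite -scalemxAr (mulmxA X) osp_X_Yodd mulmxBl -(mulmxA _ X) Xw mulmx0 subr0.
  by rewrite -mulmxA.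
rewrite doubleS [X ^+ _]exprSr_mx [X ^+ _.+1]exprSr_mx -(mulmxA _ X) -(mulmxA _ X) E2.
rewrite -scalemxAr E scalerA weight_prodSr add0n.
by rewrite -mulmxA.
Qed.

(** Replacing v by Y^2 v uses up two powers of Y and multiplies the bottom vector by (i + 1)(H + i +
    1); once Y^2 has been applied K times nothing is left. *)
Lemma weight_prod_highest K i (v : 'cV[k]_m) : X ^+ i.*2.+2 *m v = 0 -> Y ^+ K.*2 *m v = 0 ->
  weight_prod i.+1 K *m (X ^+ i.*2.+1 *m v) = 0.
Proof.
elim: K i v => [|K IH] i v Xv Yv.
  by move: Yv; rewrite expr0_mx mul1mx => ->; rewrite !mulmx0.
set w := X ^+ _ *m v.
have Xw : X *m w = 0 by rewrite mulmxA -exprS_mx.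
have XYv : X ^+ i.*2.+2 *m (Y *m v) = i.+1%:R *: w.
  by rewrite mulmxA osp_Xeven_Y mulmxDl -mulmxA Xv mulmx0 add0r -scalemxAl.
have E : X ^+ i.+1.*2.+1 *m (Y *m (Y *m v)) = i.+1%:R *: ((H + i.+1%:R%:M) *m w).
  rewrite (mulmxA _ Y (Y *m v)) osp_Xodd_Y mulmxBl -(mulmxA _ (X ^+ _) (Y *m v)).
  rewrite -(mulmxA Y (X ^+ _) (Y *m v)) [X ^+ i.+1.*2.+1]exprS_mx.
  rewrite -(mulmxA X (X ^+ _) (Y *m v)) doubleS XYv -!scalemxAr Xw.
  by rewrite mulmx0 scaler0 subr0.
have /eqP : weight_prod i.+2 K *m (i.+1%:R *: ((H + i.+1%:R%:M) *m w)) = 0.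
  rewrite -E; apply: IH.
    by rewrite exprS_mx -mulmxA E -scalemxAr X_weight // scaler0.
  by rewrite (mulmxA _ Y) (mulmxA _ Y) -!exprSr_mx.
rewrite -scalemxAr scaler_eq0; move/pcharf0P: k0 => -> /=.
by rewrite mulmxA => /eqP.
Qed.

Section Coprime.
Variable L : 'cV[k]_m -> Prop.
Hypothesis L_sub : forall u w, L u -> L w -> L (u - w).
Hypothesis L_scale : forall c u, L u -> L (c *: u).
Hypothesis L_weight : forall c u, L u -> L ((H + c%:M) *m u).

(** Bezout by hand, modulo an H-stable subspace L: (H + j) - (H + b) is the scalar j - b, nonzero in
    characteristic 0. *)
Lemma weight_coprime1 b j K u : (b < j)%N -> L ((H + b%:R%:M) *m u) ->
  L (weight_prod j K *m u) -> L u.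
Proof.
elim: K j u => [|K IH] j u bj Lb /=; first by rewrite mul1mx.
rewrite -mulmxA => LP; have Lj : L ((H + j%:R%:M) *m u).
  apply: IH LP; first exact: ltnW.
  by rewrite mulmxA weight_factorC -mulmxA; apply: L_weight.
have c0 : j%:R - b%:R != 0 :> k.
  by rewrite -natrB ?(ltnW bj) //; move/pcharf0P: k0 => ->; rewrite subn_eq0 -ltnNge.
rewrite -(scalerK c0 u); apply: L_scale.
have -> : (j%:R - b%:R) *: u = (H + j%:R%:M) *m u - (H + b%:R%:M) *m u.
  rewrite !mulmxDl !mul_scalar_mx opprD addrACA subrr add0r.
  by rewrite scalerBl.
exact: L_sub.
Qed.

Lemma weight_coprime j i J K u : (j + i <= J)%N -> L (weight_prod j i *m u) ->
  L (weight_prod J K *m u) -> L u.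
Proof.
elim: i j u => [|i IH] j u /=; first by rewrite mul1mx.
rewrite -mulmxA => jJ Lj LJ.
have Lu : L ((H + j%:R%:M) *m u).
  apply: IH Lj _; first by rewrite addSnnS.
  by rewrite mulmxA -weight_prod_comm -mulmxA; apply: L_weight.
by apply: weight_coprime1 Lu LJ; rewrite (leq_trans _ jJ) // addnS ltnS leq_addr.
Qed.

End Coprime.

(* On the bottom w of a chain of length 2i the two coprime products of
   weights (H + b), b < i and b >= i, both land in the image of X^(2i). *)
Lemma osp_chain_odd d v phi : is_chain X d v phi -> odd d.
Proof.
move=> [d0 Xv phiX ph]; apply/negPn/negP => nd.
(* The even length is written 2i + 2 to match the exponents above; X^(2i+1) v is the bottom of the
   chain. *)
pose i := d./2.-1; have dE : d = i.*2.+2.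
  rewrite /i -doubleS prednK; first by rewrite -[LHS]odd_double_half (negPf nd).
  by rewrite half_gt0; case: d d0 nd {Xv phiX ph i} => [|[]].
have [M YM] : exists M, Y ^+ M = 0.
  by apply: (@nilpotent_of_weight k m H Y 1 k0); rewrite ?oner_eq0 ?scale1r.
have Y2M : Y ^+ M.*2 *m v = 0 by rewrite -addnn exprD_mx YM !mul0mx.
rewrite dE in Xv phiX.
have Pw := weight_prod_highest Xv Y2M.
set w := X ^+ _ *m v in Pw.
have Xw : X *m w = 0 by rewrite mulmxA -exprS_mx.
have HXj j c : (H + c%:M) *m X ^+ j = X ^+ j *m (H + (c - j%:R)%:M).
  elim: j c => [|j IH] c; first by rewrite subr0 expr0_mx mulmx1 mul1mx.
  rewrite exprSr_mx mulmxA IH -!mulmxA; congr (_ *m _).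
  rewrite -natr1 opprD addrA; move: (c - j%:R) => e.
  rewrite mulmxDl mulmxDr HXE mul_scalar_mx mul_mx_scalar scalerBl scale1r.
  by rewrite -addrA [- X + _]addrC.
(* The image of X^d. If the bottom vector lay in it, phi X^d = 0 would contradict phi w = 1. *)
pose L (u : 'cV[k]_m) := exists y, u = X ^+ i.*2.+2 *m y.
have [y wy] : L w.
  apply: (@weight_coprime L _ _ _ 0 i.+1 i.+1 M) => //.
  - by move=> _ _ [y ->] [z ->]; exists (y - z); rewrite mulmxBr.
  - by move=> c _ [y ->]; exists (c *: y); rewrite scalemxAr.
  - by move=> c _ [y ->]; eexists; rewrite mulmxA HXj -mulmxA.
  - have [c c0 E] := weight_prod_lowest i.+1 Xw.
    by exists (c^-1 *: (Y ^+ i.+1.*2 *m w)); rewrite -scalemxAr E scalerK.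
  - by exists 0; rewrite Pw mulmx0.
have := ph i.*2.+1; rewrite dE eqxx -mulmxA -/w wy mulmxA phiX mul0mx.
by move/matrixP/(_ 0 0)/esym/eqP; rewrite !mxE oner_eq0.
Qed.

End OddBlocks.

(** * The two nilpotent cases *)

Section OspChain.
Variables (k : fieldType) (d : nat).
Hypothesis k0 : [pchar k] =i pred0.
Hypothesis d_odd : odd d.
Local Notation U := (shift_mx k d).

(* The solution of c_t + c_(t+1) = t - (d-1)/2 with c_0 = 0; it has c_d = 0
   exactly because d is odd. *)
Definition osp_coef (t : nat) : k := if odd t then t./2%:R - d./2%:R else t./2%:R.
(** For odd d, [d./2] is (d - 1)/2, and the weights are half those of [sl2_h]. *)
Definition osp_h : 'M[k]_d := diag_mx (\row_(a < d) (a%:R - d./2%:R)).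
Definition osp_y : 'M[k]_d := \matrix_(i, j) if i == j.+1 :> nat then osp_coef i else 0.

Lemma osp_h_shift : osp_h *m U - U *m osp_h = - U.
Proof.
rewrite mul_diag_mx mul_mx_diag; apply/matrixP => i j; rewrite !mxE.
case: eqP => [<-|_]; last by rewrite !mulr0 mul0r subr0 oppr0.
by rewrite -natr1; ring.
Qed.

Lemma osp_h_y : osp_h *m osp_y - osp_y *m osp_h = osp_y.
Proof.
rewrite mul_diag_mx mul_mx_diag; apply/matrixP => i j; rewrite !mxE.
case: eqP => [->|_]; last by rewrite !mulr0 mul0r subr0.
by rewrite -natr1; ring.
Qed.

Lemma osp_y_shift : U *m osp_y + osp_y *m U = osp_h.
Proof.
pose F i j : k := if i == j.+1 then osp_coef i else 0.
have -> : osp_y = \matrix_(i, j) F i j by apply/matrixP => i j; rewrite !mxE.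
rewrite mul_mx_shift mul_shift_mx; apply/matrixP => i j.
rewrite !mxE /F -val_eqE /= eqSS; have ld := ltn_ord i; have jd := ltn_ord j.
case: (eqVneq (i : nat) j) => [ij|ne]; last first.
  rewrite if_same add0r; case: ifP => // j0.
  by rewrite prednK ?lt0n ?j0 // (negPf ne).
rewrite -ij in jd *; rewrite mulr1n.
have -> : (if i == 0%N :> nat then 0 else if i == i.-1.+1 :> nat then osp_coef i else 0)
    = osp_coef i.
  by case: (i : nat) => [|l] /=; rewrite ?eqxx.
(* In the last row the shift contributes nothing, and the formula persists because [osp_coef d] is 0
   for odd d. *)
have -> : (if (i.+1 < d)%N then osp_coef i.+1 else 0) = osp_coef i.+1.
  case: ltnP => // di; have -> : i.+1 = d by apply/anti_leq; rewrite ld.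
  by rewrite /osp_coef d_odd subrr.
rewrite /osp_coef /= uphalf_half; move: (i : nat) => l.
have -> : l%:R = (odd l)%:R + l./2%:R + l./2%:R :> k.
  by rewrite -{1}(odd_double_half l) -addnn !natrD addrA.
by case: (odd l) => /=; rewrite ?natrD; ring.
Qed.

Lemma osp_y_sign : sign_mx k d *m osp_y = - (osp_y *m sign_mx k d).
Proof.
rewrite mul_diag_mx mul_mx_diag; apply/matrixP => i j; rewrite !mxE.
case: eqP => [->|_]; last by rewrite mulr0 mul0r oppr0.
by rewrite exprS; ring.
Qed.

End OspChain.

(** Conjugation by the chain basis carries the model to V. Only x times the projection appears in
    [H, x]; adding chains whose projections sum to 1 restores -x. *)
Lemma chain_osp (k : fieldType) p q (x : 'M[k]_(p + q)) d v phi eps :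
    is_chain x d v phi -> odd d -> G *m x = - (x *m G) ->
    G *m v = (eps * (-1) ^+ d.-1) *: v -> phi *m G = eps *: phi ->
  let Q := chain_cols x d v in let R := chain_rows x d phi in
  let Y := Q *m osp_y k d *m R in let H := Q *m osp_h k d *m R in
  [/\ G *m Y = - (Y *m G), x *m Y + Y *m x = H, H *m x - x *m H = - (x *m (Q *m R)) &
      H *m Y - Y *m H = Y].
Proof.
move=> ch dodd ox Gv phiG Q R Y H.
have RQ : R *m Q = 1%:M := chain_rows_cols ch.
have xQ : x *m Q = Q *m shift_mx k d := mul_chain_cols ch.
have Rx : R *m x = shift_mx k d *m R := chain_rows_mul ch.
split.
- rewrite !mulmxA (mul_chain_cols_sign ch ox Gv) -!scalemxAl -(mulmxA Q) osp_y_sign.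
  rewrite -(mulmxA _ R G) (chain_rows_sign d ox phiG) -!scalemxAr mulmxN mulNmx scalerN.
  by rewrite !mulmxA.
- rewrite !mulmxA xQ -(mulmxA _ R x) Rx !mulmxA -mulmxDl -!(mulmxA Q) -mulmxDr.
  by rewrite osp_y_shift.
- rewrite !mulmxA xQ -(mulmxA _ R x) Rx !mulmxA -mulmxBl -!(mulmxA Q) -mulmxBr.
  by rewrite osp_h_shift mulmxN mulNmx mulmxA.
- have E A B : Q *m A *m R *m (Q *m B *m R) = Q *m (A *m B) *m R.
    by rewrite !mulmxA -(mulmxA _ R Q) RQ mulmx1.
  by rewrite !E -mulmxBl -mulmxBr osp_h_y.
Qed.

(** * Neatness from a copy of osp(1|2) containing x *)

Section Representation.
Variables (k : closedFieldType) (n : nat).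
Hypothesis k0 : [pchar k] =i pred0.

Let two_neq0 : 2%:R != 0 :> k.
Proof. by move/pcharf0P: k0 => ->. Qed.

(** A representation respects parity and brackets, so the images satisfy the same commutator and
    anticommutator relations; the weight of x makes [rho x] nilpotent. *)
Lemma neat_of_osp (x Y H f : 'M[k]_(n + n)) : jordan_dec (half_square x) 0 f ->
    x \in slpart k n true -> Y \in slpart k n true ->
    x *m Y + Y *m x = H -> H *m x - x *m H = - x -> H *m Y - Y *m H = Y ->
  neat x.
Proof.
move=> jd xg Yg XY HX HY; exists 0, f; split=> // p q rho [rp rb].
have ox := (sl_odd k0 x).1 xg; have oY := (sl_odd k0 Y).1 Yg.
have eH : G *m H = H *m G by rewrite -XY mulmxDr mulmxDl !odd_mul.
have Hg : H \in slpart k n false.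
  apply/(sl_even k0); split=> //; rewrite -XY linearD /= !str_parity.
  have -> : \tr (G *m (Y *m x)) = - \tr (G *m (x *m Y)).
    by rewrite mulmxA mxtrace_mulC !mulmxA -[x *m G]opprK -ox !mulNmx raddfN.
  by rewrite subrr.
have oX := (glpart_odd two_neq0 _).1 (rp true x xg).
have oY' := (glpart_odd two_neq0 _).1 (rp true Y Yg).
have eH' := (glpart_even two_neq0 _).1 (rp false H Hg).
have xs := sl_part xg; have Ys := sl_part Yg; have Hs := sl_part Hg.
have rXY : rho x *m rho Y + rho Y *m rho x = rho H.
  by rewrite -sbr_odd // -rb // sbr_odd // XY.
have rHX : rho H *m rho x - rho x *m rho H = - rho x.
  by rewrite -sbr_even // -rb // sbr_even // HX linearN.
have rHY : rho H *m rho Y - rho Y *m rho H = rho Y.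
  by rewrite -sbr_even // -rb // sbr_even // HY.
have [j Xj] : exists j, rho x ^+ j = 0.
  apply: (@nilpotent_of_weight k _ (rho H) (rho x) (-1) k0).
    by rewrite oppr_eq0 oner_eq0.
  by rewrite rHX scaleN1r.
have [ms [jm chs]] := jordan_form k0 Xj.
exists ms => //; apply/allP => d /chs [v [phi ch]].
exact: (osp_chain_odd k0 rXY rHX rHY ch).
Qed.

End Representation.

Lemma singular_ker (k : fieldType) n (A : 'M[k]_n) : A \notin unitmx ->
  exists2 v : 'cV[k]_n, v != 0 & A *m v = 0.
Proof.
rewrite -row_full_unit -cokermx_eq0 => /mulmx_col_neq0 [w cw].
by exists (cokermx A *m w) => //; rewrite mulmxA mulmx_coker mul0mx.
Qed.

(** * The cases of the theorem *)

Section Main.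
Variables (k : closedFieldType) (n : nat).
Hypothesis k0 : [pchar k] =i pred0.
Hypothesis n_gt0 : (0 < n)%N.
Variables (x f : 'M[k]_(n + n)) (a : k) (m : nat).
Hypothesis xg : x \in slpart k n true.
Hypothesis dx : distinguished x.
Hypothesis jd : jordan_dec (half_square x) a%:M f.
Hypothesis fE : f = x *m x - a%:M.
Hypothesis fm : f ^+ m = 0.

Let two_neq0 : 2%:R != 0 :> k.
Proof. by move/pcharf0P: k0 => ->. Qed.

Let ox : G *m x = - (x *m G).
Proof. exact/(sl_odd k0). Qed.

Lemma principal_of_unit : ursubmx x \in unitmx \/ dlsubmx x \in unitmx ->
  [/\ principal_nilpotent f,
      exists e h, principal_sl2_triple e h f /\
        exists x0 x2 : 'M[k]_(n + n),
          [/\ x0 \in slpart k n true, x2 \in slpart k n true,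
              x = x0 + x2, sbr h x0 = 0 & sbr h x2 = - 2%:R *: x2] &
      strongly_balanced x].
Proof.
move=> uAB; have fm' : (x *m x - a%:M) ^+ m = 0 by rewrite -fE.
have [Q0 [R0 [Q1 [R1 [a0 [a1 [b0 [b1 [RQ0 RQ1 xE ffE]]]]]]]]] :=
  distinguished_frame k0 n_gt0 xg dx fm' uAB.
have tr := frame_principal_triple k0 n_gt0 RQ0 RQ1; rewrite -ffE -fE in tr.
have [x0 [x2 [x0g x2g xE2 h0 h2]]] := frame_weights k0 RQ0 RQ1 a0 a1 b0 b1.
rewrite -xE in xE2; have [tr' _ pf] := tr.
split=> //; last exact: (strongly_balanced_of_weights k0 jd tr' x0g x2g xE2 h0 h2).
do 2 eexists; split; first exact: tr.
by exists x0, x2.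
Qed.

(** A kernel vector of the block gives an even vector killed by x, on which f = x^2 - a acts as the
    nonzero scalar -a, against nilpotency. *)
Lemma dlsubmx_unit : a != 0 -> dlsubmx x \in unitmx.
Proof.
move=> a0; apply/negPn/negP => /singular_ker [v v0 Bv].
pose w : 'cV[k]_(n + n) := col_mx v 0.
have xw : x *m w = 0.
  rewrite (odd_blockP k0 ox) mul_block_col !mul0mx Bv mulmx0 !addr0.
  by rewrite col_mx0.
have fw j : f ^+ j *m w = (- a) ^+ j *: w.
  elim: j => [|j IH]; first by rewrite expr0_mx mul1mx scale1r.
  rewrite exprSr_mx -mulmxA {2}fE mulmxBl -mulmxA xw mulmx0 sub0r mul_scalar_mx.
  by rewrite -scaleNr -scalemxAr IH scalerA exprS.
have := fw m; rewrite fm mul0mx => /esym/eqP; rewrite scaler_eq0 expf_eq0 oppr_eq0 (negPf a0).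
by rewrite andbF /w col_mx_eq0 (negPf v0).
Qed.

(** Kernel vectors of the two blocks would be killed by x and have opposite parities, but the kernel
    of x on a single chain is a line. *)
Lemma unit_of_chain d v phi : is_chain x d v phi ->
    chain_cols x d v *m chain_rows x d phi = 1%:M ->
  ursubmx x \in unitmx \/ dlsubmx x \in unitmx.
Proof.
move=> ch p1; have [|/singular_ker [v1 v10 Av1]] := boolP (ursubmx x \in unitmx); first by left.
have [|/singular_ker [v0 v00 Bv0]] := boolP (dlsubmx x \in unitmx); first by right.
have [c1 E1] : exists c, col_mx 0 v1 = c *: (x ^+ d.-1 *m v) :> 'cV_(n + n).
  apply: (chain_ker ch); first by rewrite p1 mul1mx.
  by rewrite (odd_blockP k0 ox) mul_block_col !mul0mx Av1 mulmx0 !addr0 col_mx0.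
have [c0 E0] : exists c, col_mx v0 0 = c *: (x ^+ d.-1 *m v) :> 'cV_(n + n).
  apply: (chain_ker ch); first by rewrite p1 mul1mx.
  by rewrite (odd_blockP k0 ox) mul_block_col !mul0mx Bv0 mulmx0 !addr0 col_mx0.
have c10 : c1 != 0.
  apply: contraNneq v10 => c10; move/eqP: E1.
  by rewrite c10 scale0r col_mx_eq0 => /andP[].
move: E0; rewrite -(scalerK c10 (_ *m v)) -E1 scalerA scale_col_mx scaler0.
by case/eq_col_mx => v0E; rewrite v0E eqxx in v00.
Qed.

Hypothesis a0 : a = 0.

Lemma nilpotent_case :
  (indecomposable x fullv /\ strongly_balanced x) \/
  (exists U1 U2 : {vspace 'cV[k]_(n + n)},
     [/\ direct_decomposition fullv U1 U2,
         indecomposable x U1, indecomposable x U2,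
         odd (\dim U1) /\ odd (\dim U2) & neat x]).
Proof.
have xm : x ^+ (2 * m) = 0.
  have xx : x *m x = f by rewrite fE a0 raddf0 subr0.
  by rewrite exprM expr2 -mulmxE xx.
have n2 : (0 < n + n)%N by rewrite addn_gt0 n_gt0.
have one0 : 1%:M != 0 :> 'M[k]_(n + n).
  apply/eqP => /matrixP/(_ (Ordinal n2) (Ordinal n2)); rewrite !mxE eqxx => /eqP.
  by rewrite oner_eq0.
have [d [v [phi [eps [ch _ _ eps2 [Gv phiG]]]]]] :
    exists d v phi eps, [/\ is_chain x d v phi, 1%:M *m v = v, phi *m 1%:M = phi,
    eps * eps = 1 & G *m v = (eps * (-1) ^+ d.-1) *: v /\ phi *m G = eps *: phi].
  by apply: (@ex_graded_chain k n n two_neq0 x 1%:M (2 * m)); rewrite ?mulmx1 ?mul1mx.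
set Q := chain_cols x d v; set R := chain_rows x d phi.
pose p := Q *m R.
have Gp : G *m p = p *m G := graded_chain_proj_even ch ox Gv phiG.
have pp : p *m p = p := chain_proj_idem ch.
have px : p *m x = x *m p := chain_proj_comm ch.
have p0 : p != 0 := chain_proj_neq0 k0 ch.
have indU := chain_space_indecomposable two_neq0 ch Gp.
have [p1|p1] := eqVneq p 1%:M.
  left; split; last by case: (principal_of_unit (unit_of_chain ch p1)).
  suff <- : chain_space x d v = fullv by [].
  apply/eqP; rewrite eqEsubv subvf; apply/subvP => u _.
  by apply/(mem_chain_space _ ch); rewrite -/Q -/R -/p p1 mul1mx.
right.
have sp : str p != 0.
  apply: contraNneq p1 => sp; case: (idem_distinguished k0 n_gt0 dx Gp pp sp px) => [E|->//].
  by rewrite E eqxx in p0.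
have dodd : odd d.
  have := str_graded_chain_proj ch ox Gv; rewrite -/Q -/R -/p => E.
  by move: sp; rewrite E; case: (odd d) => //; rewrite mulr0 eqxx.
(* Both the vector and the covector of the second chain are taken fixed by 1 - p, which makes the
   two projections orthogonal on both sides. *)
pose e := 1%:M - p.
have e0 : e != 0 by rewrite subr_eq0 eq_sym.
have [d' [v' [phi' [eps' [ch' ev' phie' eps2' [Gv' phiG']]]]]] :
    exists d v phi eps, [/\ is_chain x d v phi, e *m v = v, phi *m e = phi,
    eps * eps = 1 & G *m v = (eps * (-1) ^+ d.-1) *: v /\ phi *m G = eps *: phi].
  apply: (@ex_graded_chain k n n two_neq0 x e (2 * m)) => //.
  - by rewrite mulmxBr mulmxBl Gp mulmx1 mul1mx.
  - by rewrite mulmxBr mulmxBl px mulmx1 mul1mx.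
  - by rewrite mulmxBr mulmx1 mulmxBl pp mul1mx subrr subr0.
  - by rewrite xm mul0mx.
set Q' := chain_cols x d' v'; set R' := chain_rows x d' phi'.
pose p' := Q' *m R'.
have ex : e *m x = x *m e by rewrite mulmxBr mulmxBl px mulmx1 mul1mx.
have pQ' : p *m Q' = 0.
  have := mul_chain_colsl d' ex ev'; rewrite -/Q' mulmxBl mul1mx => /eqP.
  by rewrite -subr_eq0 addrAC subrr add0r oppr_eq0 => /eqP.
have R'p : R' *m p = 0.
  have := mul_chain_rowsr d' ex phie'; rewrite -/R' mulmxBr mulmx1 => /eqP.
  by rewrite -subr_eq0 addrAC subrr add0r oppr_eq0 => /eqP.
have pp' : p *m p' = 0 by rewrite mulmxA pQ' mul0mx.
have p'p : p' *m p = 0 by rewrite -mulmxA R'p mulmx0.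
have Gp' : G *m p' = p' *m G := graded_chain_proj_even ch' ox Gv' phiG'.
have p'p' : p' *m p' = p' := chain_proj_idem ch'.
have p'x : p' *m x = x *m p' := chain_proj_comm ch'.
have p'0 : p' != 0 := chain_proj_neq0 k0 ch'.
have indU' := chain_space_indecomposable two_neq0 ch' Gp'.
have p1E : p + p' = 1%:M.
  (* With a remainder r != 0, the element str p' p - str p p' + 0 r is semisimple and commutes with
     x, hence is scalar. Multiplying by r shows it is 0; multiplying by p' then contradicts str p !=
     0. *)
  apply/eqP; rewrite eq_sym -subr_eq0 opprD addrA -/e; apply/negPn/negP => r0.
  set r := e - p' in r0.
  pose pf (i : 'I_3) := nth 0 [:: p; p'; r] i.
  pose c (i : 'I_3) := nth 0 [:: str p'; - str p; 0] i.
  have sE : \sum_i c i *: pf i = str p' *: p - str p *: p'.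
    by rewrite !big_ord_recl big_ord0 /= scale0r !addr0 scaleNr.
  have rr : [/\ p *m r = 0, p' *m r = 0, r *m p = 0, r *m p' = 0 & r *m r = r].
    have h1 : p *m r = 0 by rewrite !mulmxBr mulmx1 pp pp' !subrr.
    have h2 : p' *m r = 0 by rewrite !mulmxBr mulmx1 p'p p'p' subr0 subrr.
    split=> //.
    - by rewrite !mulmxBl mul1mx pp p'p !subrr.
    - by rewrite !mulmxBl mul1mx pp' p'p' subr0 subrr.
    - by rewrite {1}/r !mulmxBl mul1mx h1 h2 !subr0.
  case: rr => pr p'r rp rp' rr.
  have [b bE] : exists b, str p' *: p - str p *: p' = b%:M.
    apply: (distinguished_comm k0 n_gt0 dx); last first.
      by rewrite mulmxBl mulmxBr -!scalemxAl -!scalemxAr px p'x.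
    rewrite -sE; apply: semisimple_sum_idem => //.
    - case=> [[|[|[|//]]] i3]; rewrite /pf //=.
      by rewrite !mulmxBr !mulmxBl Gp Gp' mulmx1 mul1mx.
    - by case=> [[|[|[|//]]] i3]; case=> [[|[|[|//]]] j3]; rewrite /pf -val_eqE.
    - by rewrite !big_ord_recl big_ord0 /pf /= addr0 /r [p' + _]addrC subrK addrC subrK.
    - by rewrite sE linearB !linearZ /= /GRing.scale /= mulrN mulrC subrr.
  have b0 : b = 0.
    have : b%:M *m r = 0 by rewrite -bE mulmxBl -!scalemxAl pr p'r !scaler0 subrr.
    by rewrite mul_scalar_mx => /eqP; rewrite scaler_eq0 (negPf r0) orbF => /eqP.
  have : (str p' *: p - str p *: p') *m p' = 0 by rewrite bE b0 raddf0 mul0mx.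
  rewrite mulmxBl -!scalemxAl pp' scaler0 sub0r p'p' => /eqP.
  by rewrite oppr_eq0 scaler_eq0 (negPf sp) (negPf p'0).
have dodd' : odd d'.
  (* On k^(n|n) the identity has supertrace 0, so str p' = - str p. *)
  have sp' : str p' != 0.
    have : str (p + p') = 0.
      by rewrite p1E /str scalar_mx_block block_mxKul block_mxKdr subrr.
    by rewrite linearD /= => /eqP; rewrite addr_eq0 => /eqP E; move: sp; rewrite E oppr_eq0.
  have := str_graded_chain_proj ch' ox Gv'; rewrite -/Q' -/R' -/p' => E.
  by move: sp'; rewrite E; case: (odd d') => //; rewrite mulr0 eqxx.
exists (chain_space x d v), (chain_space x d' v'); split=> //.
- split; apply/eqP.
    rewrite eqEsubv subvf; apply/subvP => u _.
    rewrite -[u]mul1mx -p1E mulmxDl; apply: memv_add.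
      by apply/(mem_chain_space _ ch); rewrite -/Q -/R -/p mulmxA pp.
    by apply/(mem_chain_space _ ch'); rewrite -/Q' -/R' -/p' mulmxA p'p'.
  rewrite -subv0; apply/subvP => u; rewrite memv_cap => /andP[].
  move=> /(mem_chain_space _ ch) pu /(mem_chain_space _ ch').
  rewrite -/Q' -/R' -/p' => p'u; rewrite -/Q -/R -/p in pu.
  by rewrite memv0 -pu -p'u mulmxA pp' mul0mx.
- by rewrite (dim_chain_space ch) (dim_chain_space ch').
have [oY XY HX HY] := chain_osp ch dodd ox Gv phiG.
have [oY' XY' HX' HY'] := chain_osp ch' dodd' ox Gv' phiG'.
rewrite -/Q -/R -/p in oY XY HX HY; rewrite -/Q' -/R' -/p' in oY' XY' HX' HY'.
have RQ : R *m Q = 1%:M := chain_rows_cols ch.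
have RQ2 : R' *m Q' = 1%:M := chain_rows_cols ch'.
have RQ' : R *m Q' = 0 by rewrite -[R]mul1mx -RQ -!mulmxA (mulmxA Q) pQ' mulmx0.
have R'Q : R' *m Q = 0 by rewrite -[Q]mulmx1 -RQ !mulmxA -(mulmxA R') R'p mul0mx.
have cross A B : Q *m A *m R *m (Q' *m B *m R') = 0.
  by rewrite !mulmxA -(mulmxA _ R Q') RQ' mulmx0 !mul0mx.
have cross' A B : Q' *m A *m R' *m (Q *m B *m R) = 0.
  by rewrite !mulmxA -(mulmxA _ R' Q) R'Q mulmx0 !mul0mx.
have jd0 : jordan_dec (half_square x) 0 f by have := jd; rewrite a0 raddf0.
apply: (neat_of_osp k0 (Y := Q *m osp_y k d *m R + Q' *m osp_y k d' *m R')
  (H := Q *m osp_h k d *m R + Q' *m osp_h k d' *m R') jd0 xg).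
- by apply/(sl_odd k0); rewrite mulmxDr mulmxDl oY oY' opprD.
- by rewrite mulmxDr mulmxDl addrACA XY XY'.
- by rewrite mulmxDr mulmxDl opprD addrACA HX HX' -opprD -mulmxDr p1E mulmx1.
- rewrite !mulmxDr !mulmxDl !cross !cross' !addr0 !add0r opprD addrACA.
  by rewrite HY HY'.
Qed.

End Main.

Theorem lemma7p3p4 (k : closedFieldType) (k_char0 : [pchar k] =i pred0)
    (n : nat) (n_gt0 : (0 < n)%N) (x s f : 'M[k]_(n + n))
    (x_odd : x \in slpart k n true) (x_dist : distinguished x)
    (x_jordan : jordan_dec (half_square x) s f) :
  (exists lambda : k, s = lambda%:M) /\
  (s <> 0 ->
     [/\ principal_nilpotent f,
         exists e h, principal_sl2_triple e h f /\
           exists x0 x2 : 'M[k]_(n + n),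
             [/\ x0 \in slpart k n true, x2 \in slpart k n true,
                 x = x0 + x2, sbr h x0 = 0 & sbr h x2 = - 2%:R *: x2] &
         strongly_balanced x]) /\
  (s = 0 ->
     (indecomposable x fullv /\ strongly_balanced x) \/
     (exists U1 U2 : {vspace 'cV[k]_(n + n)},
        [/\ direct_decomposition fullv U1 U2,
            indecomposable x U1, indecomposable x U2,
            odd (\dim U1) /\ odd (\dim U2) & neat x])).
Proof.
have [a [m [sE fE fm]]] := distinguished_jordan_dec k_char0 n_gt0 x_odd x_dist x_jordan.
have n2 : (0 < n + n)%N by rewrite addn_gt0 n_gt0.
split; first by exists a.
rewrite {}sE in x_jordan *; split=> [s0|s0].
  have a0 : a != 0 by apply/eqP => a0; apply: s0; rewrite a0 raddf0.
  apply: (principal_of_unit k_char0 n_gt0 x_odd x_dist x_jordan fE fm); right.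
  exact: (dlsubmx_unit k_char0 x_odd fE fm a0).
apply: (nilpotent_case k_char0 n_gt0 x_odd x_dist x_jordan fE fm).
by move/matrixP/(_ (Ordinal n2) (Ordinal n2)): s0; rewrite !mxE eqxx.
Qed.
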